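(* Let $d\ge 1$ be an integer. Consider the following property. (R) For every $C^1$ function $c:(0,\infty)\to(0,\infty)$ such that $c'<0$ on $(0,\infty)$, $c/c'$ is convex on $(0,\infty)$ and $\lim_{x\to0+}c(x)<\infty$, setting $u(t,x)=\int_0^x c(y)^{e^{2t}}\,dy$ for $t\ge 0$, $x>0$, and letting $v(t,\cdot)$ be the inverse function of $u(t,\cdot)$ for each $t\ge0$, one has for every $f\in C^1_{b,0}(\mathbb{R}^d)$ $$v\bigl(t,\|u(t,Q_tf)\|_1\bigr)\ge v\bigl(0,\|u(0,f)\|_1\bigr)\qquad\text{for all } t\ge 0.$$ Property (R) implies both of the following. (i) (Reverse hypercontractivity) If $\alpha>0$ and $f\in L^1(\gamma_d)$ is $\gamma_d$-a.e. positive with $1/f\in L^\alpha(\gamma_d)$, then $$\|1/Q_tf\|_{e^{2t}(\alpha+1)-1}\le\|1/f\|_\alpha\quad\text{for all }t\ge 0.$$ (ii) If $f\in L^1(\gamma_d)$ and $e^f\in L^1(\gamma_d)$, then $$\|\exp(Q_tf)\|_{e^{2t}}\le\|e^f\|_1\quad\text{for all }t\ge 0.$$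
   Context: $\gamma_d$ is the standard Gaussian measure on $\mathbb{R}^d$; $L^p(\gamma_d)$ ($p>0$) is the set of measurable $f:\mathbb{R}^d\to\mathbb{R}$ with $\int|f|^p\,d\gamma_d<\infty$, and $\|f\|_p=\left(\int|f|^p\,d\gamma_d\right)^{1/p}$ (also for $p<1$). The Ornstein-Uhlenbeck semigroup is, for $f\in L^1(\gamma_d)$ and $t\ge 0$, $$(Q_tf)(x)=\int_{\mathbb{R}^d}f\bigl(e^{-t}x+\sqrt{1-e^{-2t}}\,y\bigr)\,\gamma_d(dy),$$ which is finite for $\gamma_d$-a.e. $x$. $C^1_{b,0}(\mathbb{R}^d)$ is the set of bounded $C^1$ functions $f:\mathbb{R}^d\to\mathbb{R}$ with bounded derivatives and $\inf_{x\in\mathbb{R}^d}f(x)>0$. The inverse $v(t,\cdot)$ is defined on the range of $u(t,\cdot)$. *)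

(* Defs.v *)
From HB Require Import structures.
From mathcomp Require Import all_boot all_order all_algebra.
From mathcomp Require Import all_classical all_reals all_analysis.

Set Implicit Arguments.
Unset Strict Implicit.
Unset Printing Implicit Defensive.
Import Order.TTheory GRing.Theory Num.Theory.
Import numFieldNormedType.Exports.
Local Open Scope classical_set_scope.
Local Open Scope ring_scope.

Definition measure_rV_display : measure_display -> measure_display.
Proof. exact. Qed.

(* Row vectors carry the sigma-algebra generated by the coordinates, as tuples
   do in the library; over the reals this is the Borel sigma-algebra. *)
Section measurable_rV.
Context {d} {T : measurableType d}.
Variable n : nat.

Let coord : 'I_n -> 'rV[T]_n -> T := fun i x => x ord0 i.

Let rV_set0 : g_sigma_preimage coord set0.
Proof. exact: sigma_algebra0. Qed.

Let rV_setC A : g_sigma_preimage coord A -> g_sigma_preimage coord (~` A).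
Proof. exact: sigma_algebraC. Qed.

Let rV_bigcup (F : _^nat) : (forall i, g_sigma_preimage coord (F i)) ->
  g_sigma_preimage coord (\bigcup_i (F i)).
Proof. exact: sigma_algebra_bigcup. Qed.

HB.instance Definition _ := @isMeasurable.Build (measure_rV_display d)
  'rV[T]_n (g_sigma_preimage coord) rV_set0 rV_setC rV_bigcup.

End measurable_rV.

Lemma measurable_coord d (T : measurableType d) n (i : 'I_n) :
  measurable_fun [set: 'rV[T]_n] (fun x : 'rV[T]_n => x ord0 i).
Proof.
move=> _ Y mY; rewrite setTI; apply: sub_sigma_algebra => /=.
rewrite -bigcup_seq/=; exists i => /=; first by rewrite mem_index_enum.
by exists Y => //; rewrite setTI.
Qed.

Lemma measurable_fun_coord d d' (S : measurableType d) (T : measurableType d')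
    n (f : S -> 'rV[T]_n) :
  (forall i, measurable_fun [set: S] (fun x => f x ord0 i)) ->
  measurable_fun [set: S] f.
Proof.
move=> mf.
have key : g_sigma_preimage (fun (i : 'I_n) (x : S) => f x ord0 i)
    `<=` measurable.
  apply: smallest_sub; first exact: sigma_algebra_measurable.
  by rewrite -bigcup_seq/= => A [i _ [B mB <-]]; exact: mf.
move=> _ A mA; apply: key.
have -> := g_sigma_preimage_comp (fun (i : 'I_n) (y : 'rV[T]_n) => y ord0 i) f.
by exists A.
Qed.

Section gauss.
Context {R : realType}.

Definition cons_rV n (p : measurableTypeR R * 'rV[R]_n) : 'rV[R]_n.+1 :=
  row_mx (const_mx p.1 : 'rV[R]_1) p.2.

Lemma measurable_cons_rV n : measurable_fun setT (@cons_rV n).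
Proof.
apply: measurable_fun_coord => i; rewrite /cons_rV.
have [j ->|j ->] := split_ordP (i : 'I_(1 + n)).
- apply: (eq_measurable_fun fst); last exact: measurable_fst.
  by move=> p _; rewrite (row_mxEl (const_mx p.1 : 'rV_1) p.2) mxE.
- apply: (eq_measurable_fun (fun p : measurableTypeR R * 'rV[R]_n => p.2 ord0 j)).
    by move=> p _; rewrite (row_mxEr (const_mx p.1 : 'rV_1) p.2).
  exact: measurableT_comp (measurable_coord j) measurable_snd.
Qed.

HB.instance Definition _ n :=
  isMeasurableFun.Build _ _ _ _ (@cons_rV n) (@measurable_cons_rV n).

(* The standard Gaussian measure, as the d-fold product of N(0, 1). *)
Fixpoint gauss (d : nat) : probability 'rV[R]_d R :=
  if d is n.+1 then distribution (normal_prob (0 : R) 1 \x gauss n)%E (@cons_rV n)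
  else dirac (0 : 'rV[R]_0).

End gauss.

Section definitions.
Context {R : realType}.

(* For f in L^1 the integral is finite for almost every x; on the exceptional
   null set this real-valued integral is 0 by convention. *)
Definition Q d (t : R) (f : 'rV[R]_d -> R) (x : 'rV[R]_d) : R :=
  \int[gauss d]_y f (expR (- t) *: x + Num.sqrt (1 - expR (- (2 * t))) *: y).

Definition partial d (i : 'I_d) (f : 'rV[R]_d -> R) : 'rV[R]_d -> R :=
  'D_(delta_mx ord0 i) f.

Definition C1b0 d : set ('rV[R]_d -> R) := [set f |
  [/\ (forall x i, derivable f x (delta_mx ord0 i)),
      (forall i, continuous (partial i f)),
      bounded_fun f,
      (forall i, bounded_fun (partial i f)) &
      0 < inf (range f)]].

Definition u (c : R -> R) (t x : R) : R :=
  \int[lebesgue_measure]_(y in `]0, x[) c y `^ expR (2 * t).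

(* The limit at 0+ always exists in ]0, +oo], as c is decreasing: the last
   condition says that it is finite. *)
Definition admissible (c : R -> R) : Prop :=
  [/\ (forall x, 0 < x -> 0 < c x),
      (forall x, 0 < x -> derivable c x 1 /\ {for x, continuous (derive1 c)}),
      (forall x, 0 < x -> derive1 c x < 0),
      convex_function (`]0, +oo[%classic : set R) (fun x => c x / derive1 c x) &
      cvg (c x @[x --> 0^'+])].

(* v t is the inverse of u c t on its range, and is unconstrained elsewhere. *)
Definition inverse_of_u (c : R -> R) (v : R -> R -> R) : Prop :=
  forall t x, 0 <= t -> 0 < x -> v t (u c t x) = x.

Definition pnorm d (p : R) (f : 'rV[R]_d -> R) : \bar R :=
  'N[gauss d]_(p%:E) [EFin \o f]%E.

(* u c t is bounded on the range of f and of Q t f, so both norms are finite and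
   fine loses nothing; the two norms lie in the ranges of u c 0
   and u c t. *)
Definition property_R d : Prop :=
  forall (c : R -> R) (v : R -> R -> R), admissible c -> inverse_of_u c v ->
  forall f : 'rV[R]_d -> R, C1b0 f ->
  forall t, 0 <= t ->
    v 0 (fine (pnorm 1 (u c 0 \o f))) <= v t (fine (pnorm 1 (u c t \o Q t f))).

End definitions.

(* Main.v *)
(* Fix t > 0.  For every x the law of e^-t x + sqrt(1 - e^-2t) Y, with Y standard
   Gaussian, has a bounded density with respect to gauss d, because its covariance
   is strictly smaller.  Hence convergence in L^1(gauss d) of f_n to f gives
   Q t f_n x --> Q t f x at every x, and Fatou's lemma carries an upper bound for
   the integral of psi (Q t f_n) over to psi (Q t f).

   Property (R) with c(y) = (y + e)^-(alpha + 1), applied to f - e, is (i) for f in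
   C1b0 with f > e: here u and v are explicit and the shift by e cancels.  With
   c(y) = exp(-y) it is (ii) for f = K - h with h + 1 in C1b0.  In both cases c / c'
   is affine.  A nonnegative integrable function is an L^1-limit of nonnegative C^1
   functions with bounded derivatives: the sets whose indicator is so approximable
   form a sigma-algebra containing the half-spaces {x_j >= a}.  One applies this to
   f and adds a small constant for (i), and to n - min(f, n) for (ii); this keeps
   f_n bounded below, resp. above, so that the tangent lines of y^-alpha, resp.
   exp, control the right-hand sides. *)

Require Import Defs.
From mathcomp Require Import all_boot all_order all_algebra.
From mathcomp Require Import all_classical all_reals all_analysis.
From mathcomp Require Import measurable_realfun ring lra.

Set Implicit Arguments.
Unset Strict Implicit.
Unset Printing Implicit Defensive.
Import Order.TTheory GRing.Theory Num.Theory.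
Import numFieldNormedType.Exports.
Local Open Scope classical_set_scope.
Local Open Scope ring_scope.

(** * Affine images of the Gaussian measure *)

Section gaussian_line.
Context {R : realType}.
Local Notation mu := (@lebesgue_measure R).

Lemma measurable_affineR (a s : R) :
  @measurable_fun _ _ (measurableTypeR R) (measurableTypeR R) setT
    (fun y => a + s * y).
Proof. by apply: measurable_funD => //; exact: measurable_funM. Qed.

Definition affineR (a s : R) : {mfun measurableTypeR R >-> measurableTypeR R} :=
  @mfun_Sub _ _ (measurableTypeR R) (measurableTypeR R) _
    (mem_set (measurable_affineR a s)).

(** The scaled image measure and Lebesgue measure agree on the intervals []x, y]], and a measure is
    determined by these values. *)
Lemma lebesgue_affine (a s : R) : 0 < s ->
  forall A : set (measurableTypeR R), measurable A ->
  (s%:E * mu ((fun y : R => (a + s * y)%R) @^-1` A) = mu A)%E.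
Proof.
move=> s0 A mA.
rewrite [RHS](@lebesgue_measure_unique R
  (mscale (NngNum (ltW s0)) (pushforward mu (affineR a s))))//.
move=> X [[x y] /= xy <-]; rewrite /mscale /= /pushforward.
have -> : (fun y : R => a + s * y) @^-1` `]x, y] = `](x - a) / s, (y - a) / s]%classic.
  apply/seteqP; split => z /=; rewrite !in_itv/=.
    by rewrite ltr_pdivrMr// ler_pdivlMr// => /andP[? ?]; apply/andP; split; lra.
  by rewrite ltr_pdivrMr// ler_pdivlMr// => /andP[? ?]; apply/andP; split; lra.
rewrite !lebesgue_measure_itv/= !lte_fin ltr_pM2r ?invr_gt0// ltrD2r.
case: ifPn => _; last by rewrite mule0.
by rewrite -!EFinD -EFinM; congr EFin; field; rewrite gt_eqF.
Qed.

(** Completing the square: the difference of the two exponents is a square divided by 2 (1 - s^2),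
    which is positive because s < 1. *)
Lemma normal_pdf_affine (a s y : R) : 0 < s -> s < 1 ->
  normal_pdf 0 1 y <= expR (a ^+ 2 / (2 * (1 - s ^+ 2))) * normal_pdf 0 1 (a + s * y).
Proof.
move=> s0 s1; rewrite !normal_pdfE ?oner_neq0//.
rewrite mulrCA ler_pM2l ?normal_peak_gt0 ?oner_neq0// /normal_fun -expRD ler_expR !subr0.
have s21 : 0 < 1 - s ^+ 2 by rewrite subr_gt0 expr_lt1// ltW.
rewrite expr1n -mulr_natl mulr1 -subr_ge0.
have -> : a ^+ 2 / (2 * (1 - s ^+ 2)) + - (a + s * y) ^+ 2 / 2%:R - - y ^+ 2 / 2%:R
  = (s * a - (1 - s ^+ 2) * y) ^+ 2 / (2 * (1 - s ^+ 2)).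
  by field; rewrite gt_eqF.
by rewrite divr_ge0 ?sqr_ge0// mulr_ge0// ltW.
Qed.

Lemma normal_prob_affine (a s : R) : 0 < s -> s < 1 -> exists2 C : R, 0 <= C &
  forall A : set (measurableTypeR R), measurable A ->
  (normal_prob (0 : R) 1 ((fun y : R => (a + s * y)%R) @^-1` A)
   <= C%:E * normal_prob (0 : R) 1 A)%E.
Proof.
move=> s0 s1.
pose K := expR (a ^+ 2 / (2 * (1 - s ^+ 2))).
(* K bounds the ratio of the densities, and 1 / s is the Jacobian of the change of variable. *)
exists (K / s); first by rewrite divr_ge0 ?expR_ge0// ltW.
move=> A mA.
pose phi := affineR a s.
have mphi : measurable_fun setT phi by [].
have mB : measurable (phi @^-1` A) by rewrite -[_ @^-1` _]setTI; exact: mphi.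
pose p (y : measurableTypeR R) := (normal_pdf (0 : R) 1 y)%:E.
have mp : measurable_fun setT p.
  by apply/measurable_EFinP; exact: measurable_normal_pdf.
rewrite /normal_prob.
apply: (@le_trans _ _ (\int[mu]_(x in phi @^-1` A) (K%:E * p (phi x)))%E).
  apply: ge0_le_integral => //.
  - by move=> x _; rewrite lee_fin normal_pdf_ge0.
  - exact: measurable_funTS.
  - apply: measurable_funTS; apply: emeasurable_funM => //.
    exact: measurableT_comp mp mphi.
  - by move=> x _; rewrite -EFinM lee_fin normal_pdf_affine.
rewrite ge0_integralZl//=; last 3 first.
  - apply: measurable_funTS; exact: measurableT_comp mp mphi.
  - by move=> x _; rewrite lee_fin normal_pdf_ge0.
  - by rewrite lee_fin expR_ge0.
rewrite EFinM -muleA lee_pmul2l ?lte_fin ?expR_gt0//.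
have p0 y : (0 <= p y)%E by rewrite lee_fin normal_pdf_ge0.
have := @ge0_integral_pushforward _ _ _ _ _ _ mphi mu A p mA (measurable_funTS mp).
move=> /(_ (fun y _ => p0 y)) /= <-.
have s1E : 1%E = (s^-1%:E * s%:E)%E by rewrite -EFinM mulVf// gt_eqF.
rewrite -[leLHS]mul1e s1E -muleA.
rewrite lee_pmul2l ?lte_fin ?invr_gt0//.
have := @ge0_integral_mscale _ _ _ (pushforward mu phi) A mA (NngNum (ltW s0)) _
  (measurable_funTS mp).
move=> /(_ mphi (fun y _ => p0 y)) /esym E.
have leE (x y : \bar R) : x = y -> (x <= y)%E by move=> ->.
apply: (le_trans (leE _ _ E)); apply: leE; apply: eq_measure_integral => B mB' _.
exact: lebesgue_affine.
Qed.

End gaussian_line.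

Section gauss_affine.
Context {R : realType}.

Lemma gaussSE n (A : set 'rV[R]_n.+1) :
  gauss n.+1 A =
  (\int[normal_prob (0 : R) 1]_x gauss n (xsection (@cons_rV R n @^-1` A) x))%E.
Proof. by []. Qed.

Lemma measurable_affine_rV n (b s : R) : measurable_fun [set: 'rV[R]_n * 'rV[R]_n]
  (fun p => b *: p.1 + s *: p.2).
Proof.
apply: measurable_fun_coord => i.
apply: (eq_measurable_fun (fun p : 'rV[R]_n * 'rV[R]_n => b * p.1 ord0 i + s * p.2 ord0 i)).
  by move=> p _; rewrite !mxE.
apply: measurable_funD; apply: measurable_funM => //.
  exact: measurableT_comp (measurable_coord i) measurable_fst.
exact: measurableT_comp (measurable_coord i) measurable_snd.
Qed.

Lemma measurable_affine n (a : 'rV[R]_n) (s : R) : measurable_fun [set: 'rV[R]_n]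
  (fun y => a + s *: y).
Proof.
apply: measurable_fun_coord => i.
apply: (eq_measurable_fun (fun p : 'rV[R]_n => a ord0 i + s * p ord0 i)).
  by move=> p _; rewrite !mxE.
apply: measurable_funD => //; apply: measurable_funM => //.
exact: measurable_coord.
Qed.

Lemma cons_rV_affine n (s : R) (p q : measurableTypeR R * 'rV[R]_n) :
  cons_rV p + s *: cons_rV q = cons_rV ((p.1 : R) + s * q.1, p.2 + s *: q.2).
Proof.
by apply/rowP => i; rewrite !mxE; case: (@fintype.split 1 n i) => j; rewrite !mxE.
Qed.

(** Induction on the dimension: the map acts on each coordinate separately, so the induction
    hypothesis bounds the sections, the one-dimensional case bounds the integral over the first
    coordinate, and the constants multiply. In dimension 0 the map is the identity. *)
Lemma gauss_affine (s : R) : 0 < s -> s < 1 -> forall n (a : 'rV[R]_n),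
  exists2 C : R, 0 <= C & forall A : set 'rV[R]_n, measurable A ->
  (gauss n ((fun y => a + s *: y)%R @^-1` A) <= C%:E * gauss n A)%E.
Proof.
move=> s0 s1; elim=> [a|n ih a].
  exists 1 => // A mA; rewrite mul1e.
  suff -> : (fun y : 'rV[R]_0 => a + s *: y) = id by [].
  by apply/funext => y; rewrite [LHS]thinmx0 [RHS]thinmx0.
pose a1 : R := a ord0 (@lshift 1 n ord0).
pose a2 : 'rV[R]_n := @rsubmx R 1 1 n a.
have aE : a = @cons_rV R n (a1, a2).
  rewrite /cons_rV /a2 -[LHS](@hsubmxK R 1 1 n); congr (@row_mx _ 1 1 n _ _).
  by apply/rowP => i; rewrite !mxE; congr (a _ _); apply/val_inj; rewrite /= ord1.
have [C1 C10 h1] := normal_prob_affine a1 s0 s1.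
have [C2 C20 h2] := ih a2.
exists (C2 * C1); first exact: mulr_ge0.
move=> A mA.
have mB : measurable (@cons_rV R n @^-1` A).
  by rewrite -[_ @^-1` _]setTI; exact: measurable_cons_rV.
set B := @cons_rV R n @^-1` A in mB *.
pose G (x : measurableTypeR R) := gauss n (xsection B x).
have mG : measurable_fun setT G by exact: measurable_fun_xsection.
pose phi := affineR a1 s.
have mphi : measurable_fun setT phi by [].
rewrite !gaussSE -/B.
apply: (@le_trans _ _ (\int[normal_prob (0 : R) 1]_x (C2%:E * G (phi x)))%E).
  apply: ge0_le_integral => //.
  - apply: measurable_fun_xsection; rewrite -[_ @^-1` _]setTI.
    apply: measurable_cons_rV => //; rewrite -[_ @^-1` _]setTI.
    exact: measurable_affine.
  - by apply: measurable_funeM; exact: measurableT_comp mG mphi.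
  - move=> x _; apply: le_trans (h2 _ _); last exact: measurable_xsection.
    rewrite le_eqVlt; apply/orP; left; apply/eqP; congr (gauss n _).
    by apply/seteqP; split => y; rewrite /xsection/= !in_setE /B /= aE cons_rV_affine.
- rewrite ge0_integralZl//=; last first.
    exact: measurableT_comp mG mphi.
  rewrite EFinM -muleA lee_wpmul2l ?lee_fin//.
  have := @ge0_integral_pushforward _ _ _ _ _ _ mphi (normal_prob (0:R) 1) setT G
    measurableT mG (fun _ _ => measure_ge0 _ _).
  rewrite preimage_setT => <-.
  have leE (x y : \bar R) : x = y -> (x <= y)%E by move=> ->.
  (* C1 times the integral is an integral against the scaled measure, so an inequality between
     measures becomes one between integrals. *)
  have := @ge0_integral_mscale _ _ _ (normal_prob (0:R) 1) setT measurableT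
    (NngNum C10) _ mG.
  move=> /(_ (fun _ _ => measure_ge0 _ _)) /leE E; apply: le_trans E.
  exact: ge0_le_measure_integral.
Qed.

End gauss_affine.

(** * The Ornstein-Uhlenbeck semigroup on L^1 *)

Section ornstein_uhlenbeck.
Context {R : realType} (d : nat).
Implicit Types (f g : 'rV[R]_d -> R) (x a : 'rV[R]_d) (t : R).
Local Notation gamma := (gauss d : probability 'rV[R]_d R).

Lemma ge0_integral_gauss_affine (s : R) a : 0 < s -> s < 1 ->
  exists2 C : R, 0 <= C & forall F : 'rV[R]_d -> \bar R,
    measurable_fun setT F -> (forall y, 0 <= F y)%E ->
  (\int[gamma]_y F (a + s *: y)%R <= C%:E * \int[gamma]_y F y)%E.
Proof.
move=> s0 s1; have [C C0 hC] := gauss_affine s0 s1 a.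
exists C => // F mF F0.
have mphi := measurable_affine a s.
have := @ge0_integral_pushforward _ _ _ _ _ _ mphi gamma setT F measurableT mF
  (fun _ _ => F0 _).
rewrite preimage_setT => <-.
have leE (x y : \bar R) : x = y -> (x <= y)%E by move=> ->.
have := @ge0_integral_mscale _ _ _ gamma setT measurableT (NngNum C0) _ mF.
move=> /(_ (fun _ _ => F0 _)) /leE E; apply: le_trans E.
exact: ge0_le_measure_integral.
Qed.

Definition ou_scale t : R := Num.sqrt (1 - expR (- (2 * t))).

Lemma ou_scale_gt0 t : 0 < t -> 0 < ou_scale t.
Proof. by move=> t0; rewrite sqrtr_gt0 subr_gt0 expR_lt1 oppr_lt0 mulr_gt0. Qed.

Lemma ou_scale_lt1 t : 0 < t -> ou_scale t < 1.
Proof.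
move=> t0; rewrite -[ltRHS]sqrtr1 ltr_sqrt// ltrBlDr ltrDl; exact: expR_gt0.
Qed.

Definition ou_shift t f x := fun y => f (expR (- t) *: x + ou_scale t *: y).

Lemma measurable_ou_shift t f x : measurable_fun setT f ->
  measurable_fun setT (ou_shift t f x).
Proof. by move=> mf; exact: measurableT_comp mf (measurable_affine _ _). Qed.

Lemma QE t f x : Q t f x = \int[gamma]_y ou_shift t f x y.
Proof. by []. Qed.

Lemma Q0 f : Q 0 f = f.
Proof.
apply/funext => x; rewrite /Q mulr0 oppr0 expR0 subrr sqrtr0 scale1r.
under eq_Rintegral do rewrite scale0r addr0.
by rewrite Rintegral_cst//= probability_setT mulr1.
Qed.

Lemma integrable_ou_shift t f x : 0 < t -> gamma.-integrable setT (EFin \o f) ->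
  gamma.-integrable setT (EFin \o ou_shift t f x).
Proof.
move=> t0 /integrableP[/measurable_EFinP mf fi]; apply/integrableP; split.
  by apply/measurable_EFinP; exact: measurable_ou_shift.
have [C C0] :=
  ge0_integral_gauss_affine (expR (- t) *: x) (ou_scale_gt0 t0) (ou_scale_lt1 t0).
move=> /(_ (fun y => `|(f y)%:E|%E)) /= h; apply: le_lt_trans (h _ _) _ => //.
  by apply/measurable_EFinP; exact: measurableT_comp.
by rewrite lte_mul_pinfty.
Qed.

Definition L1dist f g : \bar R := (\int[gamma]_x `|f x - g x|%:E)%E.

(** C bounds the density of the shifted law; it depends on t and x but not on f and g, so that L^1
    convergence gives convergence at every x. *)
Lemma Q_L1_lipschitz t x : 0 < t -> exists2 C : R, 0 <= C & forall f g,
  gamma.-integrable setT (EFin \o f) -> gamma.-integrable setT (EFin \o g) ->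
  (`|Q t f x - Q t g x|%:E <= C%:E * L1dist f g)%E.
Proof.
move=> t0.
have [C C0 hC] :=
  ge0_integral_gauss_affine (expR (- t) *: x) (ou_scale_gt0 t0) (ou_scale_lt1 t0).
exists C => // f g fi gi.
have fsi := integrable_ou_shift x t0 fi.
have gsi := integrable_ou_shift x t0 gi.
rewrite !QE -RintegralB//.
have fgi : gamma.-integrable setT (EFin \o (fun y => ou_shift t f x y - ou_shift t g x y)).
  exact: (integrableB measurableT fsi gsi).
apply: (@le_trans _ _ (\int[gamma]_y `|ou_shift t f x y - ou_shift t g x y|%:E)%E).
  rewrite EFin_normr_Rintegral//.
  by apply: le_abse_integral => //; move/integrableP : fgi => [].
apply: (hC (fun y => `|f y - g y|%:E)) => //.
apply/measurable_EFinP; apply: measurableT_comp => //; apply: measurable_funB.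
  by move/integrableP : fi => [/measurable_EFinP].
by move/integrableP : gi => [/measurable_EFinP].
Qed.

Lemma Q_cvg t f (f_ : nat -> 'rV[R]_d -> R) (e_ : nat -> R) x : 0 < t ->
  gamma.-integrable setT (EFin \o f) ->
  (forall n, gamma.-integrable setT (EFin \o f_ n)) ->
  (forall n, L1dist (f_ n) f <= (e_ n)%:E)%E ->
  e_ n @[n --> \oo] --> (0 : R) ->
  Q t (f_ n) x @[n --> \oo] --> Q t f x.
Proof.
move=> t0 fi f_i fe e0; have [C C0 hC] := Q_L1_lipschitz x t0.
have Ce0 : C * e_ n @[n --> \oo] --> (0 : R).
  by rewrite -(mulr0 C); apply: cvgM => //; exact: cvg_cst.
apply/cvgrPdist_le => e e_gt0.
move/cvgrPdist_le : Ce0 => /(_ e e_gt0).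
apply: filterS => n; rewrite sub0r normrN => /(le_trans (ler_norm _)).
rewrite distrC; apply: le_trans; rewrite -lee_fin EFinM.
by apply: (le_trans (hC _ _ _ _)) => //; rewrite lee_wpmul2l ?lee_fin.
Qed.

(** This allows a function to be changed on a null set, for instance an almost everywhere positive f
    to be replaced by its absolute value, with the same value of [Q t f] at every point. *)
Lemma Q_L1dist_eq0 t f g x : 0 < t ->
  gamma.-integrable setT (EFin \o f) -> gamma.-integrable setT (EFin \o g) ->
  L1dist f g = 0%E -> Q t f x = Q t g x.
Proof.
move=> t0 fi gi fg0; have [C C0 /(_ _ _ fi gi)] := Q_L1_lipschitz x t0.
by rewrite fg0 mule0 lee_fin normr_le0 subr_eq0 => /eqP.
Qed.

Lemma QB t f g x : 0 < t ->
  gamma.-integrable setT (EFin \o f) -> gamma.-integrable setT (EFin \o g) ->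
  Q t (fun y => f y - g y) x = Q t f x - Q t g x.
Proof.
by move=> t0 fi gi; rewrite !QE -RintegralB//; exact: integrable_ou_shift.
Qed.

Lemma Q_cst t (k : R) x : Q t (cst k) x = k.
Proof. by rewrite /Q Rintegral_cst//= probability_setT mulr1. Qed.

Lemma integrable_cst_gauss (k : R) : gamma.-integrable setT (EFin \o cst k).
Proof. exact: finite_measure_integrable_cst. Qed.

Lemma le_Q t f g x : 0 < t ->
  gamma.-integrable setT (EFin \o f) -> gamma.-integrable setT (EFin \o g) ->
  (forall y, f y <= g y) -> Q t f x <= Q t g x.
Proof.
move=> t0 fi gi fg; rewrite !QE; apply: le_Rintegral => //.
- exact: integrable_ou_shift.
- exact: integrable_ou_shift.
- by move=> y _; exact: fg.
Qed.

(** The positive and negative parts are treated separately, since Tonelli's theorem for nonnegative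
    functions asks for no integrability on the product space. *)
Lemma measurable_Q t f : 0 < t -> gamma.-integrable setT (EFin \o f) ->
  measurable_fun setT (Q t f).
Proof.
move=> t0 /[dup] fi /integrableP[/measurable_EFinP mf _].
pose F (p : 'rV[R]_d * 'rV[R]_d) := f (expR (- t) *: p.1 + ou_scale t *: p.2).
have mF : measurable_fun setT F.
  exact: measurableT_comp mf (measurable_affine_rV _ _).
pose Fp p := (Num.max (F p) 0)%:E; pose Fn p := (Num.max (- F p) 0)%:E.
have mFp : measurable_fun setT Fp.
  by apply/measurable_EFinP; exact: measurable_maxr.
have mFn : measurable_fun setT Fn.
  by apply/measurable_EFinP; apply: measurable_maxr => //; exact: measurableT_comp.
apply: measurableT_comp; first exact: fine_measurable.
apply: (eq_measurable_fun (fun x => fubini_F gamma Fp x - fubini_F gamma Fn x)%E).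
  move=> x _; rewrite /fubini_F [RHS]integralE; congr (_ - _)%E.
    by apply: eq_integral => y _; rewrite funeposE /Fp /F/= -EFin_max.
  by apply: eq_integral => y _; rewrite funenegE /Fn /F/= -EFin_max.
apply: emeasurable_funB.
  apply: measurable_fun_fubini_tonelli_F => // p; by rewrite lee_fin le_max lexx orbT.
apply: measurable_fun_fubini_tonelli_F => // p; by rewrite lee_fin le_max lexx orbT.
Qed.

End ornstein_uhlenbeck.

(** * L1-density of smooth functions *)

Section bdd.
Context {R : realType} (T : Type).
Implicit Types f g : T -> R.

Definition bdd f := exists M, forall x, `|f x| <= M.

Lemma bddD f g : bdd f -> bdd g -> bdd (fun x => f x + g x).
Proof.
move=> [M fM] [N gN]; exists (M + N) => x.
by rewrite (le_trans (ler_normD _ _))// lerD.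
Qed.

Lemma bddM f g : bdd f -> bdd g -> bdd (fun x => f x * g x).
Proof.
by move=> [M fM] [N gN]; exists (M * N) => x; rewrite normrM ler_pM.
Qed.

Lemma bdd_fun f : bdd f -> bounded_fun (f : T -> R^o).
Proof.
move=> [M fM]; exists M; split; first exact: num_real.
by move=> N MN x _ /=; exact: le_trans (fM x) (ltW MN).
Qed.

End bdd.

Section smooth_functions.
Context {R : realType} (d : nat).
Implicit Types (f g : 'rV[R]_d -> R) (x : 'rV[R]_d).

(** These are the regularity conditions of [C1b0] without the lower bound, which makes the class
    stable under sums, products and negation. Continuity of f is recorded for the partial
    derivatives of products, and measurability because it refers to the sigma-algebra of the
    coordinates. *)
Definition smooth f : Prop := [/\ continuous f,
  (forall x i, derivable f x (delta_mx ord0 i)),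
  (forall i, continuous (partial i f)),
  bdd f /\ (forall i, bdd (partial i f)) & measurable_fun setT f].

Lemma smooth_cst (k : R) : smooth (cst k).
Proof.
have pE i : partial i (cst k : 'rV[R]_d -> R) = cst 0.
  by apply/funext => x; rewrite /partial derive_cst.
split => //.
- exact: cst_continuous.
- by move=> i; rewrite pE; exact: cst_continuous.
- split; first by exists `|k|.
  by move=> i; rewrite pE; exists 0 => x; rewrite normr0.
Qed.

Lemma smoothD f g : smooth f -> smooth g -> smooth (fun x => f x + g x).
Proof.
move=> [cf df cpf [bf bpf] mf] [cg dg cpg [bg bpg] mg].
have pE i : partial i (fun x => f x + g x) = (fun x => partial i f x + partial i g x).
  by apply/funext => x; rewrite /partial deriveD.
split.
- by move=> x; exact: cvgD (cf x) (cg x).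
- by move=> x i; exact: derivableD.
- by move=> i; rewrite pE => x; exact: cvgD (cpf i x) (cpg i x).
- by split => [|i]; rewrite ?pE; exact: bddD.
- exact: measurable_funD.
Qed.

Lemma smoothM f g : smooth f -> smooth g -> smooth (fun x => f x * g x).
Proof.
move=> [cf df cpf [bf bpf] mf] [cg dg cpg [bg bpg] mg].
have pE i : partial i (fun x => f x * g x) =
    (fun x => f x * partial i g x + g x * partial i f x).
  by apply/funext => x; rewrite /partial deriveM.
split.
- by move=> x; exact: cvgM (cf x) (cg x).
- by move=> x i; exact: derivableM.
- by move=> i; rewrite pE => x; 
  exact: (cvgD (cvgM (cf x) (cpg i x)) (cvgM (cg x) (cpf i x))).
- by split => [|i]; rewrite ?pE; [exact: bddM|apply: bddD; exact: bddM].
- exact: measurable_funM.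
Qed.

Lemma smoothZ (k : R) f : smooth f -> smooth (fun x => k * f x).
Proof. by move=> sf; apply: smoothM => //; exact: smooth_cst. Qed.

Lemma smooth_onem f : smooth f -> smooth (fun x => 1 - f x).
Proof.
move=> sf; under eq_fun do rewrite -mulN1r.
by apply: smoothD; [exact: smooth_cst|exact: smoothZ].
Qed.

Lemma smooth_coord (phi : R -> R) (j : 'I_d) :
  (forall y, derivable phi y 1) -> continuous (derive1 phi) ->
  bdd phi -> bdd (derive1 phi) ->
  smooth (fun x : 'rV[R]_d => phi (x ord0 j)).
Proof.
move=> dphi cdphi bphi bdphi.
have cphi : continuous phi.
  by move=> y; apply/differentiable_continuous/derivable1_diffP.
have ccoord : continuous (fun x : 'rV[R]_d => x ord0 j).
  by move=> x; exact: coord_continuous.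
(* The difference quotient in direction i is that of phi in direction 1 if i = j and in direction 0
   otherwise; this treats both cases at once. *)
have qE x i :
    (fun h : R => h^-1 *: (((fun x : 'rV[R]_d => phi (x ord0 j)) \o shift x)
      (h *: delta_mx ord0 i) - phi (x ord0 j)))
  = (fun h : R => h^-1 *: ((phi \o shift (x ord0 j)) (h *: ((i == j)%:R : R))
      - phi (x ord0 j))).
  by apply/funext => h /=; rewrite !mxE eqxx/= [(j == i)]eq_sym.
have dphi' y (b : bool) : derivable phi y (b%:R : R).
  by case: b => //; exact: derivable0.
have pE i : partial i (fun x : 'rV[R]_d => phi (x ord0 j)) =
    (fun x => (i == j)%:R * derive1 phi (x ord0 j)).
  apply/funext => x; rewrite /partial /derive qE -/(derive _ _ _) derive1E.
  by case: eqP => _; rewrite ?derive0 ?mul0r ?mul1r.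
split.
- by move=> x; apply: continuous_comp; [exact: ccoord|exact: cphi].
- by move=> x i; rewrite /derivable qE; exact: dphi'.
- have cdc : continuous (fun x : 'rV[R]_d => derive1 phi (x ord0 j)).
    by move=> x; apply: continuous_comp; [exact: ccoord|exact: cdphi].
  move=> i; rewrite pE => x.
  have cc : continuous (cst (i == j)%:R : 'rV[R]_d -> R) by exact: cst_continuous.
  exact: (cvgM (cc x) (cdc x)).
- split; first by case: bphi => M hM; exists M.
  move=> i; rewrite pE; apply: bddM; last by case: bdphi => M hM; exists M.
  by exists `|(i == j)%:R|.
- have mphi : measurable_fun setT phi by exact: continuous_measurable_fun.
  exact: measurableT_comp mphi (measurable_coord j).
Qed.

End smooth_functions.

(** * Logistic functions as smooth approximations of indicators of rays *)

Section sigmoid.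
Context {R : realType}.

Definition sigmoid (b c y : R) : R := (1 + expR (- (b * y + c)))^-1.

Lemma sigmoid_den_gt0 (b c y : R) : 0 < 1 + expR (- (b * y + c)).
Proof. by rewrite addr_gt0// expR_gt0. Qed.

Lemma sigmoid_ge0 b c y : 0 <= sigmoid b c y.
Proof. by rewrite invr_ge0 ltW// sigmoid_den_gt0. Qed.

Lemma sigmoid_le1 b c y : sigmoid b c y <= 1.
Proof. by rewrite invf_le1 ?sigmoid_den_gt0// lerDl expR_ge0. Qed.

(** The derivative is a polynomial in the function itself, so its continuity and boundedness come
    for free. *)
Lemma is_derive_sigmoid (b c y : R) :
  is_derive y 1 (sigmoid b c) (b * (sigmoid b c y * (1 - sigmoid b c y))).
Proof.
have h : 1 + expR (- (b * y + c)) != 0 by rewrite gt_eqF// sigmoid_den_gt0.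
have h1 : is_derive y 1 (fun z => - (b * z + c)) (- b).
  by apply: is_derive_eq; rewrite /GRing.scale/= mulr1 addr0.
have h2 : is_derive y 1 (expR \o (fun z => - (b * z + c))) (expR (- (b * y + c)) * - b).
  exact: is_derive1_comp.
have h3 : is_derive y 1 (cst 1 + (expR \o (fun z => - (b * z + c))))
    (0 + expR (- (b * y + c)) * - b).
  exact: is_deriveD.
have h4 := @is_deriveV R (cst 1 + (expR \o (fun z => - (b * z + c)))) y _ 1 h h3.
have -> : b * (sigmoid b c y * (1 - sigmoid b c y)) =
    - ((cst 1 + (expR \o (fun z => - (b * z + c)))) : R -> R) y ^- 2 *:
    (0 + expR (- (b * y + c)) * - b).
  rewrite /sigmoid /GRing.scale/= fctE/=.
  by field.
exact: h4.
Qed.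

(* The exponent is n^2 (y - a) + n: the term n makes the limit 1 also at y = a. *)
Lemma cvg_sigmoid_ray (a y : R) :
  sigmoid (n%:R ^+ 2) (n%:R - n%:R ^+ 2 * a) y @[n --> \oo] --> ((a <= y)%R%:R : R).
Proof.
have e0 : expR (- (n%:R : R)) @[n --> \oo] --> (0 : R).
  exact: (cvg_comp _ _ (@cvgr_idn R) (@cvgr_expR R)).
suff le_e : \forall n \near \oo,
    `|(a <= y)%R%:R - sigmoid (n%:R ^+ 2) (n%:R - n%:R ^+ 2 * a) y|
    <= expR (- (n%:R : R)).
  apply/cvgrPdist_le => e e_gt0; move/cvgrPdist_le : e0 => /(_ e e_gt0).
  apply: filterS2 le_e => n h1; rewrite sub0r normrN ger0_norm ?expR_ge0//.
  exact: le_trans.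
have [ay|ya] := leP a y.
  apply: nearW => n; rewrite ger0_norm ?subr_ge0 ?sigmoid_le1//.
  have -> : 1%:R - sigmoid (n%:R ^+ 2) (n%:R - n%:R ^+ 2 * a) y =
      expR (- (n%:R ^+ 2 * y + (n%:R - n%:R ^+ 2 * a)))
      * sigmoid (n%:R ^+ 2) (n%:R - n%:R ^+ 2 * a) y.
    have := sigmoid_den_gt0 (n%:R ^+ 2) (n%:R - n%:R ^+ 2 * a) y; rewrite /sigmoid.
    by set E := expR _ => E0; field; rewrite gt_eqF.
  apply: (le_trans (ler_piMr (expR_ge0 _) (sigmoid_le1 _ _ _))).
  rewrite ler_expR lerN2 addrCA -mulrBr lerDl.
  by rewrite mulr_ge0 ?sqr_ge0// subr_ge0.
near=> n; rewrite sub0r normrN ger0_norm ?sigmoid_ge0//.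
rewrite /sigmoid [leRHS]expRN lef_pV2 ?posrE ?expR_gt0 ?sigmoid_den_gt0//.
rewrite (@le_trans _ _ (expR (- (n%:R ^+ 2 * y + (n%:R - n%:R ^+ 2 * a)))))// ?lerDr//.
rewrite ler_expR.
(* For such n, n^2 (a - y) is at least 2 n, which absorbs the extra term n and leaves an error of at
   most exp(-n), as in the other case. *)
have n1 : 2 <= n%:R * (a - y).
  by rewrite -ler_pdivrMr ?subr_gt0//; near: n; exact: nbhs_infty_ger.
have n0 : 0 <= n%:R :> R by [].
nra.
Unshelve. all: by end_near. Qed.

Lemma smooth_sigmoid d (b c : R) (j : 'I_d) :
  smooth (fun x : 'rV[R]_d => sigmoid b c (x ord0 j)).
Proof.
have dE : derive1 (sigmoid b c) = (fun y => b * (sigmoid b c y * (1 - sigmoid b c y))).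
  by apply/funext => y; rewrite derive1E; case: (is_derive_sigmoid b c y).
have cs : continuous (sigmoid b c).
  move=> y; apply/differentiable_continuous/derivable1_diffP.
  by case: (is_derive_sigmoid b c y).
have bs : bdd (sigmoid b c).
  by exists 1 => y; rewrite ger0_norm ?sigmoid_ge0 ?sigmoid_le1.
apply: smooth_coord => //.
- by move=> y; case: (is_derive_sigmoid b c y).
- rewrite dE => y.
  have cc k : continuous (cst k : R -> R) by exact: cst_continuous.
  exact: (cvgM (cc b y) (cvgM (cs y) (cvgB (cc 1 y) (cs y)))).
- rewrite dE; apply: bddM; first by exists `|b|.
  apply: bddM => //; exists 1 => y.
  by rewrite ger0_norm ?subr_ge0 ?sigmoid_le1// gerBl sigmoid_ge0.
Qed.

End sigmoid.

(** * Approximation of nonnegative integrable functions in L^1 *)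

Section density.
Import HBNNSimple.
Context {R : realType} (d : nat).
Implicit Types (f g h : 'rV[R]_d -> R) (A B : set 'rV[R]_d) (P : set ('rV[R]_d -> R)).
Local Notation gamma := (gauss d : probability 'rV[R]_d R).

Lemma measurable_dist f g : measurable_fun setT f -> measurable_fun setT g ->
  measurable_fun setT (fun x => `|f x - g x|%:E).
Proof.
move=> mf mg; apply/measurable_EFinP; apply: measurableT_comp => //.
exact: measurable_funB.
Qed.

(** Starting from an arbitrary pointwise bound, this serves the triangle inequality, sums and
    products alike. *)
Lemma L1dist_le_add f g f1 g1 f2 g2 :
  measurable_fun setT f -> measurable_fun setT g ->
  measurable_fun setT f1 -> measurable_fun setT g1 ->
  measurable_fun setT f2 -> measurable_fun setT g2 ->
  (forall x, `|f x - g x| <= `|f1 x - g1 x| + `|f2 x - g2 x|) ->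
  (L1dist f g <= L1dist f1 g1 + L1dist f2 g2)%E.
Proof.
move=> mf mg mf1 mg1 mf2 mg2 le; rewrite /L1dist -ge0_integralD//; last 2 first.
- exact: measurable_dist.
- exact: measurable_dist.
apply: ge0_le_integral => //.
- exact: measurable_dist.
- by apply: emeasurable_funD; exact: measurable_dist.
- by move=> x _; rewrite -EFinD lee_fin.
Qed.

Lemma L1dist_dominated (f_ : nat -> 'rV[R]_d -> R) f g :
  (forall n, measurable_fun setT (f_ n)) -> measurable_fun setT f ->
  gamma.-integrable setT (EFin \o g) ->
  (forall x, f_ n x @[n --> \oo] --> f x) ->
  (forall n x, `|f_ n x| <= g x) ->
  forall e, 0 < e -> exists n, (L1dist f (f_ n) <= e%:E)%E.
Proof.
move=> mf_ mf ig f_f f_g e e0.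
have [] := @dominated_convergence _ _ _ gamma setT measurableT
  (fun n => EFin \o f_ n) (EFin \o f) (EFin \o g) _ _ _ ig _.
- by move=> n; exact/measurable_EFinP.
- exact/measurable_EFinP.
- by apply: aeW => x _; apply: cvg_EFin; [exact: nearW|exact: f_f].
- by apply: aeW => x n _; rewrite lee_fin.
move=> _ /fine_cvgP[fin /cvgrPdist_le /(_ e e0) le_e].
have [n [_ /= finn le_en]] : exists n, [/\ True,
    (\int[gamma]_x `|(f_ n x)%:E - (f x)%:E| \is a fin_num)%E &
    `|0 - fine (\int[gamma]_x `|(f_ n x)%:E - (f x)%:E|)%E| <= e].
  have [N _ hN] := filterI fin le_e.
  by exists N; have [? ?] := hN N (leqnn N).
exists n; rewrite sub0r normrN in le_en.
rewrite (_ : L1dist f (f_ n) = \int[gamma]_x `|(f_ n x)%:E - (f x)%:E|)%E; last first.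
  by apply: eq_integral => x _; rewrite distrC.
by rewrite -(fineK finn) lee_fin (le_trans (ler_norm _)).
Qed.

Definition L1approx P f := forall e, 0 < e ->
  exists2 g, P g & (L1dist f g <= e%:E)%E.

(** The L^1-closure of P is closed: half of the error is spent on h and half on approximating h. *)
Lemma L1approx_trans P f : measurable_fun setT f -> P `<=` measurable_fun setT ->
  (forall e, 0 < e -> exists h, [/\ measurable_fun setT h, L1approx P h &
    (L1dist f h <= e%:E)%E]) -> L1approx P f.
Proof.
move=> mf mP fP e e0; have e20 : 0 < e / 2 by rewrite divr_gt0.
have [h [mh /(_ _ e20)[g Pg hg] fh]] := fP _ e20.
exists g => //; rewrite (splitr e) EFinD; apply: le_trans (leeD fh hg).
apply: L1dist_le_add => //; try exact: mP.
by move=> x; rewrite -[f x - g x](subrKA (h x)) ler_normD.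
Qed.

(** The range [0, 1] is preserved by complements and products, and it keeps errors from growing in
    products. *)
Definition smooth01 f := smooth f /\ forall x, 0 <= f x <= 1.

Lemma measurable_smooth01 : smooth01 `<=` measurable_fun setT.
Proof. by move=> f [[]]. Qed.

Definition approximable A := measurable A /\ L1approx smooth01 \1_A.

Lemma L1distxx f : L1dist f f = 0%E.
Proof. by rewrite /L1dist integral0_eq// => x _; rewrite subrr normr0. Qed.

Lemma approximable0 : approximable set0.
Proof.
split => // e e0; exists (cst 0).
  by split; [exact: smooth_cst|move=> x; rewrite lexx/=].
by rewrite indic0 L1distxx lee_fin ltW.
Qed.

Lemma approximableC A : approximable A -> approximable (~` A).
Proof.
move=> [mA aA]; split; first exact: measurableC.
move=> e e0; have [g [sg g01] Ag] := aA _ e0.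
exists (fun x => 1 - g x).
  split; first exact: smooth_onem.
  by move=> x; have /andP[? ?] := g01 x; rewrite subr_ge0 gerBl; apply/andP.
apply: le_trans Ag; rewrite /L1dist le_eqVlt; apply/orP; left; apply/eqP.
apply: eq_integral => x _; rewrite indicC -normrN; congr (`| _ |%:E).
by rewrite indicE; case: (x \in A) => /=; ring.
Qed.

(** The error of a product telescopes as 1_A (1_B - h) + (1_A - g) h, and the factors 1_A and h are
    at most 1. *)
Lemma approximableI A B : approximable A -> approximable B -> approximable (A `&` B).
Proof.
move=> [mA aA] [mB aB]; split; first exact: measurableI.
move=> e e0; have e20 : 0 < e / 2 by rewrite divr_gt0.
have [g [sg g01] Ag] := aA _ e20; have [h [sh h01] Bh] := aB _ e20.
exists (fun x => g x * h x).
  split; first exact: smoothM.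
  move=> x; have /andP[? ?] := g01 x; have /andP[? ?] := h01 x.
  by rewrite mulr_ge0// mulr_ile1.
rewrite (splitr e) EFinD; apply: le_trans (leeD Ag Bh).
have [_ _ _ _ mg] := sg; have [_ _ _ _ mh] := sh.
apply: L1dist_le_add => //.
  by apply: measurable_indic; exact: measurableI.
  exact: measurable_funM.
move=> x; rewrite (_ : \1_(A `&` B) x = \1_A x * \1_B x :> R); last by rewrite indicI.
have /andP[? ?] := g01 x; have /andP[? ?] := h01 x.
have -> : \1_A x * \1_B x - g x * h x = \1_A x * (\1_B x - h x) + (\1_A x - g x) * h x :> R.
  by ring.
rewrite addrC (le_trans (ler_normD _ _))// lerD//.
  by rewrite normrM ler_piMr// ger0_norm.
by rewrite normrM ler_piMl// indicE normr_nat lern1 leq_b1.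
Qed.

Lemma approximableU A B : approximable A -> approximable B -> approximable (A `|` B).
Proof.
move=> aA aB; rewrite -[_ `|` _]setCK setCU.
by apply/approximableC/approximableI; exact: approximableC.
Qed.

(** The indicators of the finite unions [F n] are eventually constant at each point and bounded by
    1, so dominated convergence applies. *)
Lemma approximable_bigcup (A_ : (set 'rV[R]_d)^nat) : (forall n, approximable (A_ n)) ->
  approximable (\bigcup_n A_ n).
Proof.
move=> aA; pose F n := \big[setU/set0]_(i < n) A_ i.
have aF n : approximable (F n).
  rewrite /F; elim: n => [|n ih]; first by rewrite big_ord0; exact: approximable0.
  by rewrite big_ord_recr/=; exact: approximableU.
have mU : measurable (\bigcup_n A_ n) by apply: bigcup_measurable => n _; case: (aA n).
split => //; apply: L1approx_trans; [exact: measurable_indic|exact: measurable_smooth01|].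
move=> e e0.
have [||||| n hn] := @L1dist_dominated (fun n => \1_(F n))
  \1_(\bigcup_n A_ n) (cst 1) _ _ _ _ _ e e0.
- by move=> n; apply: measurable_indic; case: (aF n).
- exact: measurable_indic.
- exact: integrable_cst_gauss.
- move=> x; apply: cvg_near_cst.
  have [[N _ ANx]|Ux] := pselect ((\bigcup_n A_ n) x).
    exists N.+1 => // n /= Nn; rewrite !indicE !mem_set//; first by exists N.
    by rewrite /F -bigcup_mkord; exists N.
  apply: nearW => n; rewrite !indicE !memNset//.
  by rewrite /F -bigcup_mkord => -[k _ Akx]; apply: Ux; exists k.
- by move=> n x; rewrite indicE normr_nat lern1 leq_b1.
exists \1_(F n); split => //; last by case: (aF n).
by apply: measurable_indic; case: (aF n).
Qed.

(** The logistic functions converge everywhere, also on the boundary hyperplane, so its being a null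
    set need not be shown. *)
Lemma approximable_ray (j : 'I_d) (a : R) :
  approximable ((fun x : 'rV[R]_d => x ord0 j) @^-1` `[a, +oo[).
Proof.
set A := _ @^-1` _.
have mA : measurable A.
  by rewrite -[A]setTI; exact: measurable_coord.
split => //; apply: L1approx_trans; [exact: measurable_indic|exact: measurable_smooth01|].
move=> e e0.
pose s n (x : 'rV[R]_d) := sigmoid (n%:R ^+ 2) (n%:R - n%:R ^+ 2 * a) (x ord0 j) : R.
have ss n : smooth (s n) by exact: smooth_sigmoid.
have s01 n x : 0 <= s n x <= 1 by rewrite sigmoid_ge0 sigmoid_le1.
have [||||| n hn] := @L1dist_dominated s \1_A (cst 1) _ _ _ _ _ e e0.
- by move=> n; case: (ss n).
- exact: measurable_indic.
- exact: integrable_cst_gauss.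
- move=> x; rewrite (_ : \1_A x = (a <= x ord0 j)%R%:R); first exact: cvg_sigmoid_ray.
  rewrite indicE (_ : (x \in A) = (a <= x ord0 j)%R)//.
  by apply/idP/idP; rewrite inE /A/= in_itv/= andbT.
- by move=> n x; have /andP[s0 s1] := s01 n x; rewrite ger0_norm.
exists (s n); split => //; first by case: (ss n).
by move=> e' e'0; exists (s n) => //; rewrite L1distxx lee_fin ltW.
Qed.

Lemma approximable_measurable A : measurable A -> approximable A.
Proof.
apply: smallest_sub.
  split; first exact: approximable0.
    by move=> B aB; rewrite setTD; exact: approximableC.
  exact: approximable_bigcup.
rewrite -bigcup_seq/= => B [j _ [C mC <-]]; rewrite setTI.
(* The Borel sets of the line are generated by the closed rays, so a second induction over a
   generated sigma-algebra reduces C to a ray. *)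
have : <<s @RGenCInfty.G R >> C.
  have := mC; rewrite -[X in X _ -> _]/((@ocitv R).-sigma.-measurable).
  by rewrite RGenCInfty.measurableE.
suff : <<s @RGenCInfty.G R >> `<=`
    (fun C => approximable ((fun x : 'rV[R]_d => x ord0 j) @^-1` C)).
  exact.
apply: smallest_sub.
  split.
  - by rewrite preimage_set0; exact: approximable0.
  - by move=> E aE; rewrite setTD preimage_setC; exact: approximableC.
  - by move=> E aE; rewrite preimage_bigcup; exact: approximable_bigcup.
by move=> _ [a ->]; exact: approximable_ray.
Qed.

Definition smooth_ge0 f := smooth f /\ forall x, 0 <= f x.

Lemma measurable_smooth_ge0 : smooth_ge0 `<=` measurable_fun setT.
Proof. by move=> f [[]]. Qed.

Lemma L1approx_ge0D f g : measurable_fun setT f -> measurable_fun setT g ->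
  L1approx smooth_ge0 f -> L1approx smooth_ge0 g ->
  L1approx smooth_ge0 (fun x => f x + g x).
Proof.
move=> mf mg af ag e e0; have e20 : 0 < e / 2 by rewrite divr_gt0.
have [f1 [sf1 f10] ff1] := af _ e20; have [g1 [sg1 g10] gg1] := ag _ e20.
exists (fun x => f1 x + g1 x).
  by split; [exact: smoothD|move=> x; rewrite addr_ge0].
rewrite (splitr e) EFinD; apply: le_trans (leeD ff1 gg1).
have mf1 := measurable_smooth_ge0 (conj sf1 f10).
have mg1 := measurable_smooth_ge0 (conj sg1 g10).
apply: L1dist_le_add => //; try exact: measurable_funD.
by move=> x; rewrite opprD addrACA ler_normD.
Qed.

Lemma L1approx_indic (c : R) A : 0 <= c -> measurable A ->
  L1approx smooth_ge0 (fun x => c * \1_A x).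
Proof.
move=> c0 mA e e0; have c10 : 0 < c + 1 by rewrite ltr_wpDl.
(* Dividing by c + 1 instead of c covers c = 0. *)
have [_ /(_ (e / (c + 1)))[|g [sg g01] Ag]] := approximable_measurable mA.
  by rewrite divr_gt0.
exists (fun x => c * g x).
  split; first exact: smoothZ.
  by move=> x; rewrite mulr_ge0//; case/andP: (g01 x).
rewrite /L1dist; under eq_integral do rewrite -mulrBr normrM EFinM.
have mg : measurable_fun setT g by case: sg.
rewrite ge0_integralZl//; last by apply: measurable_dist => //; exact: measurable_indic.
rewrite ger0_norm//; apply: (@le_trans _ _ (c%:E * (e / (c + 1))%:E)%E).
  by rewrite lee_wpmul2l ?lee_fin.
rewrite -EFinM lee_fin mulrCA; apply: ler_piMr; first exact: ltW.
by rewrite ler_pdivrMr// mul1r lerDl.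
Qed.

(** Simple functions increasing to f are dominated by f, hence close to it in L^1; each is a finite
    nonnegative combination of indicators. *)
Lemma L1approx_smooth_ge0 f : gamma.-integrable setT (EFin \o f) ->
  (forall x, 0 <= f x) -> L1approx smooth_ge0 f.
Proof.
move=> fi f0; have mEf : measurable_fun setT (EFin \o f) by case/integrableP : fi.
have mf : measurable_fun setT f by exact/measurable_EFinP.
pose s n := nnsfun_approx measurableT mEf n.
have ms n : measurable_fun setT (s n) by [].
have sf x : s n x @[n --> \oo] --> f x.
  have := @cvg_nnsfun_approx _ _ _ _ measurableT _ mEf (fun x _ => f0 x) x I.
  by move/fine_cvgP => [].
have s_le n x : s n x <= f x.
  rewrite -(cvg_lim _ (sf x))//; apply: nondecreasing_cvgn_le.
    by move=> m k mk; exact/lefP/nd_nnsfun_approx.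
  by apply/cvg_ex; exists (f x); exact: sf.
apply: L1approx_trans => // [|e e0]; first exact: measurable_smooth_ge0.
have [||||n hn] := @L1dist_dominated (fun n => s n) f f _ _ fi _ _ e e0 => //.
  by move=> n x; rewrite ger0_norm.
exists (s n); split => //.
have -> : (s n : 'rV[R]_d -> R) =
    (fun x => \sum_(y <- finmap.enum_fset (fset_set (range (s n))))
      y * \1_(s n @^-1` [set y]) x).
  apply/funext => x; rewrite [LHS](fimfunE (s n)) fsbig_finite//.
have : forall y, y \in finmap.enum_fset (fset_set (range (s n))) -> 0 <= y.
  move=> y; rewrite in_fset_set// inE => -[x _ <-]; exact: fun_ge0.
(* The list of values is generalized to any list of nonnegative reals, while the level sets remain
   those of [s n]. *)
move: (finmap.enum_fset (fset_set (range (s n)))) => q; elim: q => [|y r ih] y0.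
  under eq_fun do rewrite big_nil.
  move=> e' e'0; exists (cst 0); first by split; [exact: smooth_cst|].
  by rewrite L1distxx lee_fin ltW.
under eq_fun do rewrite big_cons.
apply: L1approx_ge0D.
- apply: measurable_funM => //; exact: measurable_indic.
- by apply: measurable_sum => z; apply: measurable_funM => //; exact: measurable_indic.
- by apply: L1approx_indic => //; apply: y0; rewrite mem_head.
- by apply: ih => z zr; apply: y0; rewrite inE zr orbT.
Qed.

End density.

(** * Consequences of property (R) for smooth functions *)

Section admissible_functions.
Context {R : realType}.
Local Notation mu := (@lebesgue_measure R).
Implicit Types c f F : R -> R.

(** An affine ratio c / c' satisfies the convexity inequality with equality. Differentiability at 0
    itself provides the finite limit at 0+. *)
Lemma admissible_affine_ratio c c' (a b : R) :
  (forall y : R, 0 <= y -> is_derive y 1 c (c' y)) ->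
  (forall y : R, 0 < y -> {for y, continuous c'}) ->
  (forall y : R, 0 < y -> 0 < c y) ->
  (forall y : R, 0 < y -> c' y < 0) ->
  (forall y : R, 0 < y -> c y = (a * y + b) * c' y) ->
  admissible c.
Proof.
move=> dc cc' c0 c'0 ratio.
have c'E y : 0 < y -> derive1 c y = c' y.
  by move=> y0; rewrite derive1E; case: (dc y (ltW y0)).
split => //.
- move=> x x0; split; first by case: (dc x (ltW x0)).
  have -> : {for x, continuous (derive1 c)} = (derive1 c y @[y --> x] --> derive1 c x) by [].
  rewrite c'E//; apply: cvg_trans (cc' x x0).
  apply: near_eq_cvg; near=> y; rewrite c'E//; near: y; exact: lt_nbhsr.
- by move=> x x0; rewrite c'E// c'0.
- move=> t x y; rewrite !inE/= !in_itv/= !andbT => x0 y0.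
  have E z : 0 < z -> c z / derive1 c z = a * z + b.
    by move=> z0; rewrite c'E// ratio// mulfK// lt_eqF// c'0.
  rewrite (E x)// (E y)// E; last exact: convR_gt0.
  rewrite !convRE le_eqVlt; apply/orP; left; apply/eqP.
  rewrite /unstable.onem (_ : conv t x y = t%:num * x + (1 - t%:num) * y :> R); last by [].
  by ring.
- have c0c : c y @[y --> (0:R)^'+] --> c 0.
    apply: cvg_at_right_filter.
    by apply/differentiable_continuous/derivable1_diffP; case: (dc 0 (lexx _)).
  exact: (cvgP _ c0c).
Unshelve. all: by end_near. Qed.

(** The power of c need only agree with f on the open half-line: [u] integrates over an open
    interval, and adding the endpoints does not change the integral. *)
Lemma u_FTC c f F (t x : R) :
  (forall y : R, 0 <= y -> is_derive y 1 F (f y)) ->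
  (forall y : R, 0 <= y -> {for y, continuous f}) ->
  (forall y : R, 0 < y -> c y `^ expR (2 * t) = f y) ->
  0 < x -> u c t x = F x - F 0.
Proof.
move=> dF cf cE x0; rewrite /u.
rewrite (@eq_Rintegral _ _ _ mu _ f); last first.
  by move=> y; rewrite inE/= in_itv/= => /andP[y0 _]; rewrite cE.
have cwf : {within `[0, x], continuous f}.
  by apply: continuous_in_subspaceT => y; rewrite inE/= in_itv/= => /andP[y0 _]; exact: cf.
have mf : measurable_fun `]0, x[ (EFin \o f).
  apply/measurable_EFinP; apply: (measurable_funS (E := `[0, x]%classic)) => //.
    exact: subset_itv_oo_cc.
  exact: subspace_continuous_measurable_fun.
rewrite /Rintegral -(@integral_itv_bndoo _ 0 x (EFin \o f) true false)//=.
rewrite (@continuous_FTC2 _ f F 0 x)//.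
- have cF (y : R) : 0 <= y -> {for y, continuous F}.
    by move=> y0; apply/differentiable_continuous/derivable1_diffP; case: (dF y y0).
  split.
  + by move=> y; rewrite in_itv/= => /andP[/ltW y0 _]; case: (dF y y0).
  + apply: cvg_at_right_filter; exact: cF.
  + apply: cvg_at_left_filter; exact: cF (ltW x0).
- by move=> y; rewrite in_itv/= => /andP[/ltW y0 _]; rewrite derive1E; case: (dF y y0).
Qed.

End admissible_functions.

Section powR_lemmas.
Context {R : realType}.

Lemma powRN_le (p x y : R) : 0 <= p -> 0 < x -> x <= y -> y `^ (- p) <= x `^ (- p).
Proof.
move=> p0 x0 xy; have y0 : 0 < y := lt_le_trans x0 xy.
rewrite !powRN lef_pV2 ?posrE ?powR_gt0//.
by apply: (ge0_ler_powR p0); rewrite // nnegrE ltW.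
Qed.

(** This removes the roots from the inequality that property (R) yields for powers; there A and B
    are the integrals for f and for [Q t f], and p and q are alpha and beta. *)
Lemma powR_invN_le (p q A B : R) : 0 < p -> 0 < q -> 0 <= B -> 0 < A ->
  A `^ (- p^-1) <= B `^ (- q^-1) -> B <= A `^ (q / p).
Proof.
move=> p0 q0; rewrite le_eqVlt => /predU1P[<- _ _|B0 A0].
  by rewrite powR_ge0.
rewrite !powRN lef_pV2 ?posrE ?powR_gt0// => le.
rewrite -[leLHS](powRr1 (ltW B0)) -(mulVf (lt0r_neq0 q0)) [q / p]mulrC !powRrM.
by apply: (ge0_ler_powR (ltW q0)); rewrite // nnegrE powR_ge0.
Qed.

End powR_lemmas.

Section property_R_consequences.
Context {R : realType} (d : nat).
Implicit Types (f g h : 'rV[R]_d -> R).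
Local Notation gamma := (gauss d : probability 'rV[R]_d R).

Lemma integrable_bdd f : measurable_fun setT f -> bdd f ->
  gamma.-integrable setT (EFin \o f).
Proof.
move=> mf [M fM]; apply: (le_integrable measurableT _ _ (integrable_cst_gauss d M)).
  exact/measurable_EFinP.
by move=> x _ /=; rewrite lee_fin (le_trans (fM x))// ler_norm.
Qed.

Lemma pnorm_uE (c : R -> R) (t k : R) (phi : R -> R) g :
  (forall x, 0 < x -> u c t x = k - phi x) ->
  (forall x, 0 < g x) -> (forall x, 0 <= phi (g x) <= k) ->
  measurable_fun setT (phi \o g) ->
  fine (pnorm 1 (u c t \o g)) = k - \int[gamma]_x phi (g x).
Proof.
move=> uE g0 phik mphi; rewrite /pnorm Lnorm1.
have iphi : gamma.-integrable setT (EFin \o (phi \o g)).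
  apply: integrable_bdd => //; exists k => x.
  by have /andP[? ?] := phik x; rewrite ger0_norm.
transitivity (\int[gamma]_x (k - phi (g x))).
  apply: eq_Rintegral => x _; rewrite /= uE// ger0_norm// subr_ge0.
  by case/andP: (phik x).
rewrite RintegralB//; last exact: integrable_cst_gauss.
by rewrite Rintegral_cst//= probability_setT mulr1.
Qed.

Lemma smooth_C1b0 f (e : R) : 0 < e -> smooth f -> (forall x, e <= f x) -> C1b0 f.
Proof.
move=> e0 [cf df cpf [bf bpf] mf] ef; split => //.
- exact: bdd_fun.
- by move=> i; exact: bdd_fun.
- apply: (lt_le_trans e0); apply: lb_le_inf; first by exists (f 0), 0.
  by move=> _ [x _ <-].
Qed.

Lemma property_R_powR (alpha beta delta t : R) h : property_R (R := R) d ->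
  0 < alpha -> 0 < delta -> 0 < t -> smooth_ge0 h ->
  beta = expR (2 * t) * (alpha + 1) - 1 ->
  \int[gamma]_x (Q t (fun y => h y + delta) x `^ (- beta)) <=
  (\int[gamma]_x ((h x + delta) `^ (- alpha))) `^ (beta / alpha).
Proof.
move=> HR alpha0 delta0 t0 [sh h0] betaE.
(* One half of delta shifts c away from its singularity, the other keeps the test function h + e
   bounded below. *)
pose e := delta / 2; have e0 : 0 < e by rewrite divr_gt0.
have deltaE : delta = e + e by rewrite /e; field.
(* The power of c in [u c s] is (y + e)^(- b s - 1), with antiderivative -(y + e)^(- b s) / b s.
   Hence [b 0] and [b t] are the exponents alpha and beta; [phi s] is minus this antiderivative,
   [k s] is its value at 0, and [v s] inverts k s - phi s. *)
pose b s : R := expR (2 * s) * (alpha + 1) - 1.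
have b_gt0 s : 0 <= s -> 0 < b s.
  move=> s0; rewrite subr_gt0 (@lt_le_trans _ _ (1 * (alpha + 1)))//.
    by rewrite mul1r ltrDr.
  apply: ler_wpM2r; first by rewrite addr_ge0// ltW.
  by rewrite -[leLHS]expR0 ler_expR mulr_ge0.
have b0E : b 0 = alpha by rewrite /b mulr0 expR0; ring.
pose c (y : R) := (y + e) `^ (- (alpha + 1)).
pose phi s (y : R) := (b s)^-1 * (y + e) `^ (- b s).
pose k s := (b s)^-1 * e `^ (- b s).
pose v s z := (b s * (k s - z)) `^ (- (b s)^-1) - e.
have dpow (q y : R) : 0 <= y ->
    is_derive y 1 (fun z : R => (z + e) `^ q) (q * (y + e) `^ (q - 1)).
  move=> y0; have ye0 : 0 < y + e by rewrite ltr_wpDl.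
  have d1 : is_derive y 1 (fun z : R => z + e) (1 : R).
    by apply: is_derive_eq; rewrite addr0.
  have := @is_derive1_comp R (fun w => w `^ q) (fun z => z + e) y _ _
    (is_derive1_powR q ye0) d1.
  by rewrite mulr1.
have cpow (q y : R) : 0 <= y -> {for y, continuous (fun z : R => (z + e) `^ q)}.
  move=> y0; apply/differentiable_continuous/derivable1_diffP.
  by case: (dpow q y y0).
have adm : admissible c.
  apply: (@admissible_affine_ratio _ _
    (fun y => - (alpha + 1) * (y + e) `^ (- (alpha + 1) - 1))
    (- (alpha + 1)^-1) (- (alpha + 1)^-1 * e)).
  - move=> y /ltW y0.
    have cc : continuous (cst (- (alpha + 1)) : R -> R) by exact: cst_continuous.
    exact: (cvgM (cc y) (cpow _ y y0)).
  - by move=> y y0; rewrite powR_gt0// addr_gt0.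
  - by move=> y y0; rewrite mulNr oppr_lt0 mulr_gt0 ?powR_gt0 ?addr_gt0.
  - move=> y y0; have ye0 : 0 < y + e by rewrite addr_gt0.
    rewrite /c (powRB (r := - (alpha + 1))); last by rewrite (gt_eqF ye0) implybT.
    rewrite powRr1 ?ltW//; field.
    by rewrite !gt_eqF// addr_gt0.
have uE s x : 0 <= s -> 0 < x -> u c s x = k s - phi s x.
  move=> s0 x0; have bs0 := b_gt0 s s0.
  have dphi (y : R) : 0 <= y ->
      is_derive y 1 (fun y : R => - phi s y) ((y + e) `^ (- b s - 1)).
    move=> y0; have D := is_deriveZ (- (b s)^-1) (dpow (- b s) y y0).
    rewrite (_ : (fun y => - phi s y) =
        - (b s)^-1 *: (fun z : R => (z + e) `^ (- b s))).
      apply: is_derive_eq; rewrite /GRing.scale/= mulrA mulrNN mulVf ?mul1r//.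
      by rewrite gt_eqF.
    by apply/funext => z; rewrite /phi -mulNr.
  have cE (y : R) : 0 < y -> c y `^ expR (2 * s) = (y + e) `^ (- b s - 1).
    by move=> y0; rewrite /c -powRrM; congr (_ `^ _); rewrite /b; ring.
  by rewrite (u_FTC dphi (cpow _) cE x0) opprK addrC /phi add0r.
have bphi s y : 0 <= s -> 0 <= y -> 0 <= phi s y <= k s.
  move=> s0 y0; have bs0 := b_gt0 s s0.
  apply/andP; split; first by rewrite mulr_ge0 ?powR_ge0// invr_ge0 ltW.
  rewrite /phi /k ler_pM2l ?invr_gt0// !powRN lef_pV2 ?posrE ?powR_gt0// ?ltr_wpDl//.
  by apply: (ge0_ler_powR (ltW bs0)); rewrite ?nnegrE ?lerDr ?(ltW e0) ?addr_ge0 ?(ltW e0).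
have vK : inverse_of_u c v.
  move=> s x s0 x0; have bs0 := b_gt0 s s0.
  rewrite /v uE// subKr /phi mulrA divff ?gt_eqF// mul1r -powRrM.
  by rewrite mulrNN divff ?gt_eqF// powRr1 ?addrK// addr_ge0// ltW.
(* Property (R) is applied to f1. As [Q t] fixes constants, the shift by e in c turns f1 and
   [Q t f1] back into F and [Q t F]. *)
pose F x := h x + delta; pose f1 x := F x - e.
have sF : smooth F by apply: smoothD => //; exact: smooth_cst.
have iF : gamma.-integrable setT (EFin \o F).
  by case: sF => _ _ _ [bF _] mF; exact: integrable_bdd.
have f1E : f1 = (fun x => h x + e).
  by apply/funext => x; rewrite /f1 /F deltaE; ring.
have sf1 : smooth f1 by rewrite f1E; apply: smoothD => //; exact: smooth_cst.
have f1e x : e <= f1 x by rewrite f1E lerDr.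
have Qf1 x : Q t f1 x = Q t F x - e.
  by rewrite /f1 QB// ?Q_cst//; exact: integrable_cst_gauss.
have Qdelta x : delta <= Q t F x.
  rewrite -[leLHS](Q_cst t delta x); apply: le_Q => //; first exact: integrable_cst_gauss.
  by move=> y; rewrite /= /F lerDr.
have Qf1e x : e <= Q t f1 x by rewrite Qf1 lerBrDr -deltaE.
have := HR c v adm vK f1 (smooth_C1b0 e0 sf1 f1e) t (ltW t0).
(* Both sides of (R) are instances of this formula, at s = 0 and s = t; the constants [k s] and
   [b s] cancel. *)
have main s g : 0 <= s -> (forall x, e <= g x) -> measurable_fun setT g ->
  v s (fine (pnorm 1 (u c s \o g))) = (\int[gamma]_x (g x + e) `^ (- b s)) `^ (- (b s)^-1) - e.
  move=> s0 ge mg; have bs0 := b_gt0 s s0.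
  have mpow : measurable_fun setT (fun x => (g x + e) `^ (- b s)).
    have m1 : measurable_fun setT (fun x => g x + e) by exact: measurable_funD.
    exact: measurableT_comp (measurable_powR _) m1.
  rewrite (@pnorm_uE c s (k s) (phi s))//.
  - rewrite /v subKr RintegralZl//; first by rewrite mulrA divff ?gt_eqF// mul1r.
    apply: integrable_bdd => //; exists (b s * k s) => x.
    rewrite ger0_norm ?powR_ge0//.
    have /andP[_] := bphi s (g x) s0 (le_trans (ltW e0) (ge x)).
    by rewrite /phi ler_pdivrMl.
  - by move=> x; exact: uE.
  - by move=> x; exact: lt_le_trans (ge x).
  - by move=> x; apply: bphi => //; apply: le_trans (ge x); exact: ltW.
  - by apply: measurable_funM.
rewrite main//; last by case: sf1.
rewrite main//; [|exact: ltW|]; last first.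
  by apply: measurable_Q => //; case: sf1 => _ _ _ [bf _] mf; exact: integrable_bdd.
have btE : b t = beta by rewrite betaE.
rewrite b0E lerD2r btE.
under eq_Rintegral do rewrite f1E -addrA -deltaE.
under [X in _ <= X `^ _ -> _]eq_Rintegral do rewrite Qf1 subrK.
apply: powR_invN_le => //; first by rewrite betaE; exact: (b_gt0 t (ltW t0)).
  by apply: Rintegral_ge0 => x _; exact: powR_ge0.
have [_ _ _ [[M FM] _] mF] := sF.
(* The upper bound M of F makes the integral on the right strictly positive, as inverting the
   negative powers requires. *)
have M0 : 0 < M.
  by apply: lt_le_trans (FM 0); rewrite normr_gt0 gt_eqF// /F ltr_wpDl.
apply: (@lt_le_trans _ _ (\int[gamma]_x (M `^ (- alpha)))).
  by rewrite Rintegral_cst//= probability_setT mulr1 powR_gt0.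
have Fdelta x : delta <= F x by rewrite lerDr.
have F0 x : 0 < F x by exact: lt_le_trans (Fdelta x).
apply: le_Rintegral => //; first exact: integrable_cst_gauss.
  apply: integrable_bdd; first exact: measurableT_comp (measurable_powR _) mF.
  exists (delta `^ (- alpha)) => x; rewrite ger0_norm ?powR_ge0//.
  exact: (powRN_le (ltW alpha0) delta0 (Fdelta x)).
move=> x _; apply: (powRN_le (ltW alpha0) (F0 x)).
exact: le_trans (ler_norm _) (FM x).
Qed.

End property_R_consequences.

(** * The exponential inequality for smooth functions bounded above *)

Section property_R_expR.
Context {R : realType} (d : nat).
Implicit Types (f g h : 'rV[R]_d -> R).
Local Notation gamma := (gauss d : probability 'rV[R]_d R).

Lemma property_R_expR (K t : R) h : property_R (R := R) d ->
  0 < t -> smooth_ge0 h ->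
  \int[gamma]_x expR (expR (2 * t) * Q t (fun y => K - h y) x) <=
  (\int[gamma]_x expR (K - h x)) `^ expR (2 * t).
Proof.
move=> HR t0 [sh h0].
pose E (s : R) := expR (2 * s).
have E0 s : 0 < E s by exact: expR_gt0.
have E0E : E 0 = 1 by rewrite /E mulr0 expR0.
pose c (y : R) := expR (- y).
pose phi s (y : R) := (E s)^-1 * expR (- (E s * y)).
pose k s := (E s)^-1.
pose v s z := - (E s)^-1 * ln (E s * (k s - z)).
have dexp (q y : R) :
    is_derive y 1 (fun z : R => expR (- (q * z))) (- q * expR (- (q * y))).
  have d1 : is_derive y 1 (fun z : R => - (q * z)) (- q).
    by apply: is_derive_eq; rewrite /GRing.scale/= mulr1.
  have := @is_derive1_comp R expR (fun z => - (q * z)) y _ _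
    (is_derive_expR _) d1.
  by rewrite mulrC.
have cexp (q : R) : continuous (fun z : R => expR (- (q * z))).
  move=> y; apply/differentiable_continuous/derivable1_diffP.
  by case: (dexp q y).
have cE1 : c = (fun z => expR (- (1 * z))) by apply/funext => z; rewrite mul1r.
have adm : admissible c.
  have dc (y : R) : 0 <= y -> is_derive y 1 c (- 1 * c y).
    by move=> _; rewrite cE1; exact: dexp.
  (* Here c / c' is the constant -1. *)
  apply: (@admissible_affine_ratio _ _ (fun y => - 1 * c y) 0 (- 1) dc).
  - move=> y _; have cc : continuous (cst (- 1) : R -> R) by exact: cst_continuous.
    have ccy : {for y, continuous c} by rewrite cE1; exact: cexp.
    exact: (cvgM (cc y) ccy).
  - by move=> y y0; exact: expR_gt0.
  - by move=> y y0; rewrite mulN1r oppr_lt0 expR_gt0.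
  - by move=> y y0; rewrite mul0r add0r mulrA mulrNN !mul1r.
have uE s x : 0 <= s -> 0 < x -> u c s x = k s - phi s x.
  move=> s0 x0.
  have dphi (y : R) : 0 <= y ->
      is_derive y 1 (fun y : R => - phi s y) (expR (- (E s * y))).
    move=> y0; have D := is_deriveZ (- (E s)^-1) (dexp (E s) y).
    rewrite (_ : (fun y => - phi s y) =
        - (E s)^-1 *: (fun z : R => expR (- (E s * z)))).
      apply: is_derive_eq; rewrite /GRing.scale/= mulrA mulrNN mulVf ?mul1r//.
      by rewrite gt_eqF.
    by apply/funext => z; rewrite /phi -mulNr.
  have cE (y : R) : 0 < y -> c y `^ expR (2 * s) = expR (- (E s * y)).
    by move=> y0; rewrite /c -expRM; congr expR; rewrite /E; ring.
  rewrite (u_FTC dphi (fun y _ => cexp (E s) y) cE x0) opprK addrC /phi/k.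
  by rewrite mulr0 oppr0 expR0 mulr1.
have bphi s y : 0 <= y -> 0 <= phi s y <= k s.
  move=> y0; apply/andP; split; first by rewrite mulr_ge0 ?expR_ge0// invr_ge0 ltW.
  rewrite /phi /k ler_piMr ?invr_ge0 ?(ltW (E0 s))//.
  by rewrite -[leRHS]expR0 ler_expR oppr_le0 mulr_ge0// ltW.
have vK : inverse_of_u c v.
  move=> s x s0 x0.
  rewrite /v uE// subKr /phi mulrA divff ?gt_eqF// mul1r expRK mulrNN mulrA.
  by rewrite mulVf ?mul1r// gt_eqF.
(* Property (R) is applied to F, which is at least 1. Since K - h = (K + 1) - F, the inequality for
   K - h differs from that for -F only by the factor exp(K + 1) to the power [E t] on both sides. *)
pose F x := h x + 1.
have sF : smooth F by apply: smoothD => //; exact: smooth_cst.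
have [_ _ _ [[M FM] _] mF] := sF.
have iF : gamma.-integrable setT (EFin \o F).
  by apply: integrable_bdd => //; exists M.
have F1 x : 1 <= F x by rewrite lerDr.
have QF1 x : 1 <= Q t F x.
  by rewrite -[leLHS](Q_cst t 1 x); apply: le_Q => //; exact: integrable_cst_gauss.
have QgE x : Q t (fun y => K - h y) x = K + 1 - Q t F x.
  rewrite -(Q_cst t (K + 1) x) -QB//; last exact: integrable_cst_gauss.
  by apply: eq_Rintegral => y _ /=; rewrite /F; ring.
have int_exp (a b : R) g : measurable_fun setT g -> (forall x, 0 <= g x) -> 0 <= a ->
    gamma.-integrable setT (EFin \o (fun x => expR (b - a * g x))).
  move=> mg g0 a0; apply: integrable_bdd.
    by apply: measurableT_comp => //; apply: measurable_funB => //; exact: measurable_funM.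
  exists (expR b) => x; rewrite ger0_norm ?expR_ge0// ler_expR gerBl mulr_ge0//.
have mQF : measurable_fun setT (Q t F) by exact: measurable_Q.
have expP (a b : R) g : measurable_fun setT g -> (forall x, 0 <= g x) -> 0 <= a ->
    \int[gamma]_x expR (b - a * g x) = expR b * \int[gamma]_x expR (- (a * g x)).
  move=> mg g0 a0; rewrite -RintegralZl//; last first.
    have := int_exp a 0 _ mg g0 a0; under eq_fun do rewrite sub0r; exact.
  by apply: eq_Rintegral => x _; rewrite expRD.
under eq_Rintegral do rewrite QgE mulrBr.
rewrite expP//; last by move=> x; exact: le_trans (QF1 x).
rewrite (_ : \int[gamma]_x expR (K - h x) =
    expR (K + 1) * \int[gamma]_x expR (- (1 * F x))); last first.
  rewrite -expP//; last by move=> x; exact: le_trans (F1 x).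
  by apply: eq_Rintegral => x _; congr expR; rewrite /F; ring.
set A := \int[gamma]_x expR (- (1 * F x)).
set B := \int[gamma]_x expR (- (expR (2 * t) * Q t F x)).
have A0 : 0 < A.
  apply: (@lt_le_trans _ _ (\int[gamma]_x (expR (- M)))).
    by rewrite Rintegral_cst//= probability_setT mulr1 expR_gt0.
  apply: le_Rintegral => //; first exact: integrable_cst_gauss.
    have := int_exp 1 0 F mF (fun x => le_trans ler01 (F1 x)) ler01.
    by under eq_fun do rewrite sub0r; exact.
  by move=> x _; rewrite ler_expR mul1r lerN2; exact: le_trans (ler_norm _) (FM x).
have B0 : 0 <= B by apply: Rintegral_ge0 => x _; exact: expR_ge0.
rewrite powRM ?expR_ge0 ?(ltW A0)// -expRM [(K + 1) * _]mulrC ler_pM2l ?expR_gt0//.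
(* With this formula (R) reads -ln A <= -(ln B) / E t, that is, B is at most the power [E t] of
   A. *)
have main s g : 0 <= s -> (forall x, 1 <= g x) -> measurable_fun setT g ->
  v s (fine (pnorm 1 (u c s \o g))) = - (E s)^-1 * ln (\int[gamma]_x expR (- (E s * g x))).
  move=> s0 g1 mg; have g0 x : 0 < g x by exact: lt_le_trans (g1 x).
  have mexp : measurable_fun setT (fun x => expR (- (E s * g x))).
    by apply: measurableT_comp => //; apply: measurableT_comp => //; exact: measurable_funM.
  rewrite (@pnorm_uE _ _ c s (k s) (phi s))//.
  - rewrite /v subKr RintegralZl//; first by rewrite mulrA divff ?gt_eqF// mul1r.
    have := int_exp (E s) 0 g mg (fun x => ltW (g0 x)) (ltW (E0 s)).
    by under eq_fun do rewrite sub0r; exact.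
  - by move=> x; exact: uE.
  - by move=> x; apply: bphi; exact: ltW.
  - by apply: measurable_funM.
have := HR c v adm vK F (smooth_C1b0 ltr01 sF F1) t (ltW t0).
rewrite main// main//; last exact: ltW.
rewrite E0E -/A -/B invr1 mulN1r mulNr lerN2.
move: B0; rewrite le_eqVlt => /predU1P[<- _|B0]; first exact: powR_ge0.
rewrite ler_pdivrMl// -ln_powR ler_ln// posrE ?powR_gt0//.
Qed.

End property_R_expR.

(** * Passage to the limit *)

Section limits.
Context {R : realType} (d : nat).
Implicit Types (f g h : 'rV[R]_d -> R).
Local Notation gamma := (gauss d : probability 'rV[R]_d R).

(** Fatou's lemma, where convergence may fail at the zeros of G: there 0 is below any lower limit of
    nonnegative terms. *)
Lemma fatou_bounded (G_ : nat -> 'rV[R]_d -> R) (G : 'rV[R]_d -> R) (a : \bar R) :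
  (forall n, measurable_fun setT (G_ n)) -> measurable_fun setT G ->
  (forall n x, 0 <= G_ n x) ->
  (forall x, G x = 0 \/ G_ n x @[n --> \oo] --> G x) ->
  (forall n, (\int[gamma]_x (G_ n x)%:E <= a)%E) ->
  (\int[gamma]_x `|G x|%:E <= a)%E.
Proof.
move=> mG_ mG G_0 GG Ga.
have limn_einf_ge0 (w : nat -> \bar R) : (forall n, 0 <= w n)%E -> (0 <= limn_einf w)%E.
  move=> w0; rewrite limn_einf_lim; apply: lime_ge; first exact: is_cvg_einfs.
  by apply: nearW => n; apply: le_ereal_inf_tmp => _ [k _ <-].
have limn_einf_le (w : nat -> \bar R) : (forall n, w n <= a)%E -> (limn_einf w <= a)%E.
  move=> wa; rewrite limn_einf_lim; apply: lime_le; first exact: is_cvg_einfs.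
  apply: nearW => n; apply: le_trans (wa n).
  by apply: ereal_inf_lbound; exists n => /=.
apply: le_trans (limn_einf_le (fun n => \int[gamma]_x (G_ n x)%:E)%E Ga).
apply: le_trans (fatou gamma measurableT _ _); last 2 first.
- by move=> n; exact/measurable_EFinP.
- by move=> n x _; rewrite lee_fin.
apply: ge0_le_integral => //.
- by apply/measurable_EFinP; exact: measurableT_comp.
- rewrite (_ : (fun x => _) = (fun x => - limn_esup (fun n => - (G_ n x)%:E)))%E; last first.
    by [].
  apply: measurableT_comp => //; apply: measurable_fun_limn_esup => n.
  by apply: measurableT_comp => //; exact/measurable_EFinP.
move=> x _; have [->|cG] := GG x.
  by rewrite normr0; apply: limn_einf_ge0 => n; rewrite lee_fin.
have cGE : ((G_ n x)%:E @[n --> \oo] --> (G x)%:E)%E by apply: cvg_EFin; [exact: nearW|].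
rewrite is_cvg_limn_einfE; last by apply/cvg_ex; exists (G x)%:E.
rewrite (cvg_lim _ cGE)// ger0_norm//.
rewrite -(cvg_lim _ cG)//; apply: limr_ge; first by apply/cvg_ex; exists (G x).
exact: nearW.
Qed.

(* psi y = 0 is the case y = 0 of psi y = |1/y|^p, with Rocq's 1/0 = 0. *)
Lemma Q_fatou (psi : R -> R) (t : R) f (a : \bar R) : 0 < t ->
  gamma.-integrable setT (EFin \o f) ->
  measurable_fun setT psi -> (forall y, 0 <= psi y) ->
  (forall y, psi y = 0 \/ {for y, continuous psi}) ->
  (forall e, 0 < e -> exists g, [/\ gamma.-integrable setT (EFin \o g),
    (L1dist g f <= e%:E)%E & (\int[gamma]_x (psi (Q t g x))%:E <= a)%E]) ->
  (\int[gamma]_x (psi (Q t f x))%:E <= a)%E.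
Proof.
move=> t0 fi mpsi psi0 cpsi approx.
have /choice [g_ g_P] : forall n : nat, exists g, [/\ gamma.-integrable setT (EFin \o g),
    (L1dist g f <= (n.+1%:R^-1)%:E)%E & (\int[gamma]_x (psi (Q t g x))%:E <= a)%E].
  by move=> n; exact: approx.
have e0 : (n.+1%:R^-1 : R) @[n --> \oo] --> (0 : R) by exact: cvg_harmonic.
have Qc x : Q t (g_ n) x @[n --> \oo] --> Q t f x.
  apply: Q_cvg t0 fi _ _ e0 => n; by have [] := g_P n.
have mQ g : gamma.-integrable setT (EFin \o g) -> measurable_fun setT (psi \o Q t g).
  by move=> gi; exact: measurableT_comp mpsi (measurable_Q t0 gi).
have -> : (\int[gamma]_x (psi (Q t f x))%:E = \int[gamma]_x `|(psi \o Q t f) x|%:E)%E.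
  by apply: eq_integral => x _ /=; rewrite ger0_norm.
apply: (@fatou_bounded (fun n => psi \o Q t (g_ n))) => //.
- by move=> n; apply: mQ; have [] := g_P n.
- exact: mQ.
- by move=> n x; exact: psi0.
- move=> x; have [psi_0|c] := cpsi (Q t f x); first by left.
  by right; exact: (cvg_comp _ _ (Qc x) c).
- by move=> n; have [] := g_P n.
Qed.

(** Taking the q-th root before letting e tend to 0 avoids any appeal to continuity of the power. *)
Lemma poweR_le_of_addgt0 (B : \bar R) (A q : R) : 0 < q -> 0 <= A -> (0 <= B)%E ->
  (forall e, 0 < e -> (B <= ((A + e) `^ q)%:E)%E) -> (B `^ q^-1 <= A%:E)%E.
Proof.
move=> q0 A0 B0 BA; apply/lee_addgt0Pr => e e0.
have Ae0 : 0 <= A + e by rewrite addr_ge0// ltW.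
have qN0 : q^-1 \is Num.nneg by rewrite nnegrE invr_ge0 ltW.
have := @gt0_ler_poweR R q^-1 _ B ((A + e) `^ q)%:E _ _ (BA e e0).
rewrite poweR_EFin -powRrM divff ?gt_eqF// powRr1// EFinD; apply.
- by rewrite invr_ge0 ltW.
- by rewrite in_itv/= B0 leey.
- by rewrite in_itv/= lee_fin powR_ge0 leey.
Qed.

Lemma pnormE (p : R) g : pnorm p g = ((\int[gamma]_x (`|g x| `^ p)%:E) `^ p^-1)%E.
Proof. by rewrite /pnorm unlock. Qed.

End limits.

(** * Error bounds from tangent lines of convex functions *)

Section tangents.
Context {R : realType}.

(** The graph lies above its tangent at y, whose slope is bounded on [delta, +oo[; homogeneity
    reduces this to the tangent at 1, with r = x / y. *)
Lemma powRN_le_tangent (alpha delta x y : R) : 0 < alpha -> 0 < delta ->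
  delta <= x -> delta <= y ->
  y `^ (- alpha) <= x `^ (- alpha) + alpha * delta `^ (- alpha) / delta * `|y - x|.
Proof.
move=> a0 d0 dx dy; have x0 := lt_le_trans d0 dx; have y0 := lt_le_trans d0 dy.
pose r := x / y; have r0 : 0 < r by rewrite divr_gt0.
have xE : x = y * r by rewrite /r mulrCA divff ?mulr1// gt_eqF.
(* [exp(- alpha ln r) >= 1 - alpha ln r] and [ln r <= r - 1] *)
have h1 : 1 - alpha * (r - 1) <= r `^ (- alpha).
  rewrite /powR gt_eqF//; apply: le_trans (expR_ge1Dx _); rewrite lerD2l mulNr lerN2.
  rewrite ler_pM2l//; have := @le_ln1Dx R (r - 1); rewrite subrKC; apply.
  by rewrite ltrBrDr addNr.
have h2 : y `^ (- alpha) * (1 - alpha * (r - 1)) <= x `^ (- alpha).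
  by rewrite {1}xE (powRM _ (ltW y0) (ltW r0)) ler_pM2l ?powR_gt0//.
have h3 : y `^ (- alpha) * (alpha * (r - 1)) <= alpha * delta `^ (- alpha) / delta * `|y - x|.
  rewrite (_ : r - 1 = (x - y) / y); last by rewrite /r mulrBl divff// gt_eqF.
  rewrite mulrCA -!mulrA ler_pM2l// distrC.
  apply: (@le_trans _ _ (y `^ (- alpha) * (y^-1 * `|x - y|))).
    by rewrite ler_pM2l ?powR_gt0// mulrC ler_pM2l ?invr_gt0// ler_norm.
  apply: ler_pM; rewrite ?powR_ge0 ?mulr_ge0 ?invr_ge0 ?(ltW y0)//.
    exact: (powRN_le (ltW a0)).
  by apply: ler_wpM2r => //; rewrite lef_pV2 ?posrE.
lra.
Qed.

(** The tangent is taken at y, so only y has to be bounded above. *)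
Lemma expR_le_tangent (K x y : R) : y <= K ->
  expR y <= expR x + expR K * `|y - x|.
Proof.
move=> yK; have h1 : expR y * (1 + (x - y)) <= expR x.
  by rewrite -[in leRHS](subrKC y x) expRD ler_pM2l ?expR_gt0// expR_ge1Dx.
have h2 : expR y * (y - x) <= expR K * `|y - x|.
  apply: (@le_trans _ _ (expR y * `|y - x|)).
    by rewrite ler_pM2l ?expR_gt0// ler_norm.
  by apply: ler_wpM2r => //; rewrite ler_expR.
lra.
Qed.

End tangents.

(** * Smooth approximations with control of the right-hand sides *)

Section approximation.
Context {R : realType} (d : nat).
Implicit Types (f g h : 'rV[R]_d -> R).
Local Notation gamma := (gauss d : probability 'rV[R]_d R).

Lemma Rintegral_le_L1dist g g1 h f (A L e : R) :
  measurable_fun setT g -> measurable_fun setT g1 ->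
  measurable_fun setT h -> measurable_fun setT f ->
  (forall x, 0 <= g x) -> (forall x, 0 <= g1 x) ->
  0 <= L -> 0 < e -> (\int[gamma]_x (g1 x)%:E <= A%:E)%E ->
  (forall x, g x <= g1 x + L * `|f x - h x|) ->
  (L1dist f h <= (e / (L + 1))%:E)%E ->
  \int[gamma]_x g x <= A + e.
Proof.
move=> mg mg1 mh mf g0 g10 L0 e0 g1A gg1 fh.
have L10 : 0 < L + 1 by rewrite ltr_wpDl.
have mgE : measurable_fun setT (EFin \o g) by exact/measurable_EFinP.
have gA : (\int[gamma]_x (g x)%:E <= (A + e)%:E)%E.
  apply: (@le_trans _ _ (\int[gamma]_x ((g1 x)%:E + L%:E * `|f x - h x|%:E))%E).
    apply: ge0_le_integral => //.
    - by move=> x _; rewrite lee_fin.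
    - apply: emeasurable_funD; first exact/measurable_EFinP.
      by apply: measurable_funeM; exact: measurable_dist.
    - by move=> x _; rewrite -EFinM -EFinD lee_fin.
  rewrite ge0_integralD//; last 4 first.
  - by move=> x _; rewrite lee_fin.
  - exact/measurable_EFinP.
  - by move=> x _; rewrite -EFinM lee_fin mulr_ge0.
  - by apply: measurable_funeM; exact: measurable_dist.
  rewrite EFinD leeD// ge0_integralZl//; last exact: measurable_dist.
  apply: (@le_trans _ _ (L%:E * (e / (L + 1))%:E)%E).
    by rewrite lee_wpmul2l ?lee_fin.
  rewrite -EFinM lee_fin mulrCA; apply: ler_piMr; first exact: ltW.
  by rewrite ler_pdivrMr// mul1r lerDl.
(* The bound just proved also shows that the integral is finite, so [fine] preserves it. *)
rewrite -lee_fin /Rintegral fineK// ge0_fin_numE; first exact: le_lt_trans gA (ltry _).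
by apply: integral_ge0 => x _; rewrite lee_fin.
Qed.

Lemma L1_approx_powRN (alpha A : R) f : 0 < alpha ->
  gamma.-integrable setT (EFin \o f) -> (forall x, 0 <= f x) ->
  {ae gamma, forall x, 0 < f x} ->
  (\int[gamma]_x ((f x) `^ (- alpha))%:E <= A%:E)%E ->
  forall e a, 0 < e -> 0 < a -> exists h delta, [/\ smooth_ge0 h, 0 < delta,
    (L1dist (fun x => h x + delta)%R f <= e%:E)%E &
    \int[gamma]_x ((h x + delta) `^ (- alpha)) <= A + a].
Proof.
move=> alpha0 fi f0 fpos fA e a e0 a0.
have mf : measurable_fun setT f by case/integrableP: fi => /measurable_EFinP.
pose delta := e / 2; have delta0 : 0 < delta by rewrite divr_gt0.
pose L := alpha * delta `^ (- alpha) / delta.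
have L0 : 0 <= L.
  by rewrite /L; apply: divr_ge0; [apply: mulr_ge0; [exact: ltW|exact: powR_ge0]|exact: ltW].
(* The shift delta comes first, because the slope L depends on it. The first bound leaves a distance
   of at most e' + delta <= e, the second an excess of at most a in the integral. *)
pose e' := Num.min delta (a / (L + 1)).
have e'0 : 0 < e' by rewrite lt_min delta0 divr_gt0// ltr_wpDl.
have [h [sh h0] fh] := L1approx_smooth_ge0 fi f0 e'0.
have mh : measurable_fun setT h by case: sh.
have mpow g : measurable_fun setT g ->
    measurable_fun setT (fun x => (g x + delta) `^ (- alpha)).
  move=> mg; have m1 : measurable_fun setT (fun x => g x + delta) by exact: measurable_funD.
  exact: measurableT_comp (measurable_powR _) m1.
exists h, delta; split => //.
  have dist_delta : L1dist (cst delta) (cst 0 : 'rV[R]_d -> R) = delta%:E.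
    rewrite /L1dist; under eq_integral do rewrite /= subr0 (gtr0_norm delta0).
    by rewrite integral_cst// [X in (_ * X)%E]probability_setT mule1.
  rewrite (splitr e) EFinD.
  apply: (@le_trans _ _ (L1dist f h + L1dist (cst delta) (cst 0%R))%E).
    apply: L1dist_le_add => //; first exact: measurable_funD.
    move=> x /=; rewrite subr0 (distrC (f x)).
    by rewrite (_ : h x + delta - f x = (h x - f x) + delta) ?ler_normD//; ring.
  by rewrite dist_delta leeD//; apply: le_trans fh _; rewrite lee_fin ge_min lexx.
apply: (@Rintegral_le_L1dist _ (fun x => (f x + delta) `^ (- alpha)) h f A L a) => //.
- exact: mpow.
- exact: mpow.
- by move=> x; exact: powR_ge0.
- by move=> x; exact: powR_ge0.
(* The comparison holds only almost everywhere: where f vanishes, its negative power is 0 by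
   convention. *)
- apply: le_trans fA; apply: ae_ge0_le_integral => //.
  + by move=> x _; rewrite lee_fin powR_ge0.
  + by apply/measurable_EFinP; exact: mpow.
  + by move=> x _; rewrite lee_fin powR_ge0.
  + by apply/measurable_EFinP; exact: measurableT_comp (measurable_powR _) mf.
  + move: fpos; apply: filterS => x fx _; rewrite lee_fin.
    by apply: (powRN_le (ltW alpha0) fx); rewrite lerDl ltW.
- move=> x; have := @powRN_le_tangent R alpha delta (f x + delta) (h x + delta) alpha0 delta0.
  rewrite !lerDr => /(_ (f0 x) (h0 x)) H; apply: (le_trans H).
  by rewrite lerD2l -/L distrC opprD addrACA subrr addr0.
- by apply: le_trans fh _; rewrite lee_fin ge_min lexx orbT.
Qed.

Lemma L1_approx_expR (A : R) f :
  gamma.-integrable setT (EFin \o f) ->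
  (\int[gamma]_x (expR (f x))%:E <= A%:E)%E ->
  forall e a, 0 < e -> 0 < a -> exists h K, [/\ smooth_ge0 h,
    (L1dist (fun x => K - h x)%R f <= e%:E)%E &
    \int[gamma]_x expR (K - h x) <= A + a].
Proof.
move=> fi fA e a e0 a0; have e20 : 0 < e / 2 by rewrite divr_gt0.
have mf : measurable_fun setT f by case/integrableP: fi => /measurable_EFinP.
(* Truncation decreases exp(f) and makes n - m n nonnegative, hence approximable by smooth h >= 0.
   The level n is fixed before h, whose accuracy depends on exp(n). *)
pose m n x : R := Num.min (f x) n%:R.
have mm n : measurable_fun setT (m n) by exact: measurable_minr.
have m_le n x : `|m n x| <= `|f x|.
  rewrite /m; case: (leP (f x) n%:R) => // nf; rewrite !ger0_norm//; first exact: ltW.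
  by apply: le_trans (ltW nf).
have mi n : gamma.-integrable setT (EFin \o m n).
  apply: (le_integrable measurableT _ _ fi); first exact/measurable_EFinP.
  by move=> x _; rewrite /= lee_fin.
have [n hn] : exists n, (L1dist f (m n) <= (e / 2)%:E)%E.
  apply: (@L1dist_dominated _ _ _ _ (fun x => `|f x|)) => //.
  - by apply: (integrable_norm fi).
  - move=> x; apply: cvg_near_cst; near=> n; rewrite /m min_l//.
    by near: n; exact: nbhs_infty_ger.
pose K : R := n%:R; pose h' x := K - m n x.
have h'i : gamma.-integrable setT (EFin \o h').
  exact: (integrableB measurableT (integrable_cst_gauss d K) (mi n)).
have h'0 x : 0 <= h' x by rewrite subr_ge0 /m ge_min lexx orbT.
pose e' := Num.min (e / 2) (a / (expR K + 1)).
have e'0 : 0 < e' by rewrite lt_min e20 divr_gt0// addr_gt0// expR_gt0.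
have [h [sh h0] hh] := L1approx_smooth_ge0 h'i h'0 e'0.
have mh : measurable_fun setT h by case: sh.
have mh' : measurable_fun setT h' by exact: measurable_funB.
exists h, K; split => //.
  rewrite (splitr e) EFinD; apply: le_trans (leeD (le_trans hh _) hn); last first.
    by rewrite lee_fin ge_min lexx.
  apply: L1dist_le_add => //; first exact: measurable_funB.
  move=> x; rewrite [`|f x - _|]distrC.
  rewrite (_ : K - h x - f x = (h' x - h x) + (m n x - f x)) ?ler_normD//.
  by rewrite /h'; ring.
apply: (@Rintegral_le_L1dist _ (fun x => expR (m n x)) h h' A (expR K) a) => //.
- by apply: measurableT_comp => //; exact: measurable_funB.
- exact: measurableT_comp.
- apply: le_trans fA; apply: ge0_le_integral => //.
  + by apply/measurable_EFinP; exact: measurableT_comp.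
  + by apply/measurable_EFinP; exact: measurableT_comp.
  + by move=> x _; rewrite lee_fin ler_expR /m ge_min lexx.
- move=> x; have := @expR_le_tangent R K (m n x) (K - h x).
  rewrite gerBl => /(_ (h0 x)) H; apply: (le_trans H).
  by rewrite lerD2l (_ : K - h x - m n x = h' x - h x)// /h'; ring.
- by apply: le_trans hh _; rewrite lee_fin ge_min lexx orbT.
Unshelve. all: by end_near. Qed.

End approximation.

(** * The two inequalities for integrable functions *)

Section conclusions.
Context {R : realType} (d : nat).
Implicit Types (f g h : 'rV[R]_d -> R).
Local Notation gamma := (gauss d : probability 'rV[R]_d R).

(** By the convention 1 / 0 = 0 this includes y = 0, so no positivity of f or [Q t f] is needed to
    rewrite the norms. *)
Lemma norm_inv_powR (p y : R) : `|y^-1| `^ p = `|y| `^ (- p).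
Proof. by rewrite normfV -powR_inv1// -powRrM mulN1r. Qed.

Lemma EFin_Rintegral g : gamma.-integrable setT (EFin \o g) ->
  (\int[gamma]_x (g x)%:E = (\int[gamma]_x g x)%:E)%E.
Proof. by move=> gi; rewrite /Rintegral fineK//; exact: integrable_fin_num. Qed.

Lemma powR_norm_continuous (p y : R) : y != 0 -> {for y, continuous (fun z : R => `|z| `^ p)}.
Proof.
move=> y0; have c1 : {for `|y|, continuous (fun w : R => w `^ p)}.
  apply/differentiable_continuous/derivable1_diffP.
  have [] := is_derive1_powR p (_ : 0 < `|y|); first by rewrite normr_gt0.
  by [].
apply: (continuous_comp _ c1); exact: norm_continuous.
Qed.

Lemma reverse_hypercontractivity (alpha t : R) f : property_R (R := R) d ->
  0 < alpha -> f \in Lfun gamma 1%:E -> {ae gamma, forall x, 0 < f x} ->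
  (fun x => (f x)^-1) \in Lfun gamma alpha%:E -> 0 < t ->
  (pnorm (expR (2 * t) * (alpha + 1) - 1)%R (fun x => (Q t f x)^-1)%R
       <= pnorm alpha (fun x => (f x)^-1)%R)%E.
Proof.
move=> HR alpha0 /Lfun1_integrable fi fpos fV t0.
set beta := _ - 1; have beta0 : 0 < beta.
  rewrite subr_gt0 (@lt_le_trans _ _ (1 * (alpha + 1)))//.
    by rewrite mul1r ltrDr.
  apply: ler_wpM2r; first by rewrite addr_ge0// ltW.
  by rewrite -[leLHS]expR0 ler_expR mulr_ge0// ltW.
(* F is nonnegative everywhere and equals f almost everywhere, so [Q t] takes the same values on
   both. *)
pose F x := `|f x|.
have mf : measurable_fun setT f by case/integrableP: fi => /measurable_EFinP.
have mF : measurable_fun setT F by exact: measurableT_comp.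
have Fi : gamma.-integrable setT (EFin \o F) by exact: (integrable_norm fi).
have FQ x : Q t f x = Q t F x.
  apply: (Q_L1dist_eq0 _ t0 fi Fi); rewrite /L1dist.
  rewrite (ae_eq_integral (cst 0%E))//; first by rewrite integral0.
  - exact: measurable_dist.
  - move: fpos; apply: filterS => y fy _.
    by rewrite /F (gtr0_norm fy) subrr normr0.
pose I := (\int[gamma]_x (F x `^ (- alpha))%:E)%E.
have pnormI : pnorm alpha (fun x => (f x)^-1) = (I `^ alpha^-1)%E.
  rewrite pnormE /I; under eq_integral do rewrite norm_inv_powR.
  by [].
have I0 : (0 <= I)%E by apply: integral_ge0 => x _; rewrite lee_fin powR_ge0.
have Ify : (I < +oo)%E.
  move: fV; rewrite inE => /andP[_]; rewrite inE /= /finite_norm.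
  rewrite -/(pnorm alpha (fun x => (f x)^-1)) pnormI => /lty_poweRy; apply.
  by rewrite invr_neq0// gt_eqF.
have [A A0 IE] : exists2 A : R, 0 <= A & I = A%:E.
  by exists (fine I); rewrite ?fine_ge0// fineK// ge0_fin_numE.
pose psi (y : R) := `|y| `^ (- beta).
pose B := (\int[gamma]_x (psi (Q t F x))%:E)%E.
have B0 : (0 <= B)%E by apply: integral_ge0 => x _; rewrite lee_fin powR_ge0.
have BA a : 0 < a -> (B <= ((A + a) `^ (beta / alpha))%:E)%E.
  move=> a0; apply: Q_fatou => //.
  - exact: measurableT_comp (measurable_powR _) (@normr_measurable _ _).
  - by move=> y; exact: powR_ge0.
  - move=> y; have [->|y0] := eqVneq y 0; last by right; exact: powR_norm_continuous.
    by left; rewrite /psi normr0 powR0// oppr_eq0 gt_eqF.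
  move=> e e0.
  have [||h [delta [sh delta0 he hA]]] :=
    @L1_approx_powRN R d alpha A F alpha0 Fi (fun x => normr_ge0 _) _ _ e a e0 a0.
  - move: fpos; apply: filterS => x fx; rewrite normr_gt0 gt_eqF//.
  - by rewrite -/I IE.
  pose g x := h x + delta.
  have sg : smooth g by apply: smoothD; [case: sh|exact: smooth_cst].
  have gi : gamma.-integrable setT (EFin \o g).
    by case: sg => _ _ _ [bg _] mg; exact: integrable_bdd.
  have gdelta x : delta <= Q t g x.
    rewrite -[leLHS](Q_cst t delta x); apply: le_Q => //; first exact: integrable_cst_gauss.
    by move=> y; rewrite /= /g lerDr; case: sh.
  have Qg0 x : 0 < Q t g x by exact: lt_le_trans (gdelta x).
  exists g; split => //.
  have mQg : measurable_fun setT (Q t g) by exact: measurable_Q.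
  have psiE x : psi (Q t g x) = Q t g x `^ (- beta) by rewrite /psi gtr0_norm.
  under eq_integral do rewrite psiE.
  rewrite EFin_Rintegral; last first.
    apply: integrable_bdd; first exact: measurableT_comp (measurable_powR _) mQg.
    exists (delta `^ (- beta)) => x; rewrite ger0_norm ?powR_ge0//.
    exact: (powRN_le (ltW beta0) delta0 (gdelta x)).
  rewrite lee_fin; apply: (le_trans (property_R_powR HR alpha0 delta0 t0 sh erefl)).
  have p0 : 0 <= beta / alpha by apply: ltW; exact: divr_gt0.
  apply: (ge0_ler_powR p0) hA.
  - by rewrite nnegrE; apply: Rintegral_ge0 => x _; exact: powR_ge0.
  - by rewrite nnegrE addr_ge0// ltW.
have := poweR_le_of_addgt0 (divr_gt0 beta0 alpha0) A0 B0 BA.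
rewrite pnormI pnormE.
have -> : (\int[gamma]_x (`|(Q t f x)^-1| `^ beta)%:E = B)%E.
  by apply: eq_integral => x _; rewrite norm_inv_powR FQ.
move=> BA'.
(* The bound on the (beta / alpha)-th root of B becomes the required one after a further alpha-th
   root. *)
rewrite (_ : beta^-1 = (beta / alpha)^-1 * alpha^-1); last first.
  by field; rewrite !gt_eqF.
rewrite poweRrM IE.
have a0 : 0 <= alpha^-1 by rewrite invr_ge0 ltW.
apply: (gt0_ler_poweR a0) BA'.
- by rewrite in_itv/= poweR_ge0 leey.
- by rewrite in_itv/= lee_fin A0 leey.
Qed.

Lemma exp_hypercontractivity (t : R) f : property_R (R := R) d ->
  f \in Lfun gamma 1%:E -> (fun x => expR (f x)) \in Lfun gamma 1%:E -> 0 < t ->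
  (pnorm (expR (2 * t))%R (fun x => expR (Q t f x))
       <= pnorm 1 (fun x => expR (f x)))%E.
Proof.
move=> HR /Lfun1_integrable fi /Lfun1_integrable ei t0.
set E := expR (2 * t); have E0 : 0 < E by exact: expR_gt0.
pose A := \int[gamma]_x expR (f x).
have IE : (\int[gamma]_x (expR (f x))%:E)%E = A%:E by exact: EFin_Rintegral.
have A0 : 0 <= A by apply: Rintegral_ge0 => x _; exact: expR_ge0.
pose psi (y : R) := expR (E * y).
pose B := (\int[gamma]_x (psi (Q t f x))%:E)%E.
have B0 : (0 <= B)%E by apply: integral_ge0 => x _; rewrite lee_fin expR_ge0.
have cpsi : continuous psi.
  move=> y; apply: continuous_comp; last exact: continuous_expR.
  have cc : continuous (cst E : R -> R) by exact: cst_continuous.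
  exact: (cvgM (cc y) cvg_id).
have BA a : 0 < a -> (B <= ((A + a) `^ E)%:E)%E.
  move=> a0; apply: Q_fatou => //.
  - exact: continuous_measurable_fun.
  - by move=> y; exact: expR_ge0.
  - by move=> y; right; exact: cpsi.
  move=> e e0.
  have [|h [K [sh he hA]]] := @L1_approx_expR R d A f fi _ e a e0 a0; first by rewrite IE.
  have [hs h0] := sh; have [_ _ _ [bh _] mh] := hs.
  pose g x := K - h x.
  have mg : measurable_fun setT g by exact: measurable_funB.
  have hi : gamma.-integrable setT (EFin \o h) by exact: integrable_bdd.
  have gi : gamma.-integrable setT (EFin \o g).
    exact: (integrableB measurableT (integrable_cst_gauss d K) hi).
  have gK x : Q t g x <= K.
    rewrite -[leRHS](Q_cst t K x); apply: le_Q => //; first exact: integrable_cst_gauss.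
    by move=> y; rewrite /= /g gerBl.
  exists g; split => //.
  have mQg : measurable_fun setT (Q t g) by exact: measurable_Q.
  rewrite EFin_Rintegral; last first.
    apply: integrable_bdd.
      by apply: measurableT_comp => //; exact: continuous_measurable_fun.
    exists (expR (E * K)) => x; rewrite ger0_norm ?expR_ge0//.
    by rewrite ler_expR ler_pM2l.
  rewrite lee_fin; apply: (le_trans (property_R_expR K HR t0 sh)).
  apply: (ge0_ler_powR (ltW E0)) hA.
  - by rewrite nnegrE; apply: Rintegral_ge0 => x _; exact: expR_ge0.
  - by rewrite nnegrE addr_ge0// ltW.
have := poweR_le_of_addgt0 E0 A0 B0 BA.
rewrite pnormE /pnorm Lnorm1.
have -> : (\int[gamma]_x (`|expR (Q t f x)| `^ E)%:E = B)%E.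
  by apply: eq_integral => x _; rewrite ger0_norm ?expR_ge0// -expRM mulrC.
move=> /le_trans; apply; rewrite -IE le_eqVlt; apply/orP; left; apply/eqP.
by apply: eq_integral => x _; rewrite /= ger0_norm// expR_ge0.
Qed.

End conclusions.

Theorem proposition5p2 (R : realType) (d : nat) (d_ge1 : (1 <= d)%N) :
  property_R (R := R) d ->
  (forall (alpha : R) (f : 'rV[R]_d -> R),
    0 < alpha ->
    f \in Lfun (gauss d) 1%:E ->
    {ae gauss d, forall x, 0 < f x} ->
    (fun x => (f x)^-1) \in Lfun (gauss d) alpha%:E ->
    forall t : R, 0 <= t ->
      (pnorm (expR (2 * t) * (alpha + 1) - 1)%R (fun x => (Q t f x)^-1)%R
       <= pnorm alpha (fun x => (f x)^-1)%R)%E) /\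
  (forall f : 'rV[R]_d -> R,
    f \in Lfun (gauss d) 1%:E ->
    (fun x => expR (f x)) \in Lfun (gauss d) 1%:E ->
    forall t : R, 0 <= t ->
      (pnorm (expR (2 * t))%R (fun x => expR (Q t f x))
       <= pnorm 1 (fun x => expR (f x)))%E).
Proof.
move=> HR; split.
  move=> alpha f alpha0 f1 fpos fV t; rewrite le_eqVlt => /predU1P[<-|t0].
    by rewrite Q0 mulr0 expR0 mul1r addrK.
  exact: reverse_hypercontractivity.
move=> f f1 e1 t; rewrite le_eqVlt => /predU1P[<-|t0].
  by rewrite Q0 mulr0 expR0.
exact: exp_hypercontractivity.
Qed.
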